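(* There exists $\beta>0$, independent of the scales of $\mu$, $\underline{\boldsymbol{\kappa}}$, $\lambda$ in the range $0<\kappa_0,\kappa_1\ll1\ll\mu\lesssim\lambda\le+\infty$, and of the mesh sizes, such that the following inf-sup condition holds: $$\inf_{(\boldsymbol{u},p_t,p_p)\in\mathcal{X}_h}\ \sup_{(\boldsymbol{v},q_t,q_p)\in\mathcal{X}_h}\frac{\langle\mathcal{A}(\boldsymbol{u},p_t,p_p),(\boldsymbol{v},q_t,q_p)\rangle_{(\mathcal{X}_h^*,\mathcal{X}_h)}}{\|(\boldsymbol{u},p_t,p_p)\|_{\mathcal{X}_h}\,\|(\boldsymbol{v},q_t,q_p)\|_{\mathcal{X}_h}}\ \ge\ \beta$$ (inf and sup over nonzero elements).
   Context: Setting. $\Omega\subset\mathbb{R}^n$, $n=2,3$, is a bounded polygonal (polyhedral) Lipschitz domain; $\partial\Omega=\Gamma_p\cup\Gamma_f=\Gamma_d\cup\Gamma_t$ are partitions with $|\Gamma_d|,|\Gamma_p|>0$. $(\cdot,\cdot)$ is the $L^2(\Omega)$ inner product and $\epsilon$ the symmetric gradient. $\boldsymbol{V}=\{\boldsymbol{v}\in H^1(\Omega;\mathbb{R}^n):\boldsymbol{v}|_{\Gamma_d}=0\}$, $Q_t=L^2(\Omega)$, $Q_p=\{q\in H^1(\Omega):q|_{\Gamma_p}=0\}$, with $\|\boldsymbol{v}\|_{\boldsymbol{V}}=(2\mu\,\epsilon(\boldsymbol{v}),\epsilon(\boldsymbol{v}))^{1/2}$, $\|q\|_{Q_t}=((2\mu)^{-1}q,q)^{1/2}$,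 $\|q\|_{0,w}=(wq,q)^{1/2}$. Parameters. $\mu$ is a function with $1\lesssim\mu_{\min}\le\mu\le\mu_{\max}$ and $\mu_{\max}/\mu_{\min}$ bounded; $\lambda$ has a uniform positive lower bound and may be arbitrarily large ($\lambda^{-1}=0$ when $\lambda=+\infty$); $\alpha>0$ is constant; $0\le c_0\le s_0(x)\le c_1$; $\underline{\boldsymbol{\kappa}}$ is positive definite with $\kappa_0|\xi|^2\le\xi^T\underline{\boldsymbol{\kappa}}(x)\xi\le\kappa_1|\xi|^2$ (it stands for the hydraulic conductivity multiplied by the time step). Discretization. $\mathcal{T}_h$ is a shape-regular triangulation of $\Omega$. $\mathcal{P}_k(\mathcal{T}_h)$ denotes the continuous ($H^1$) piecewise polynomials of degree $\le k$ if $k\ge1$, and the piecewise constants if $k=0$. $Q_{p,h}\subset Q_p$ is a standard Lagrange finite element space, $\boldsymbol{V}_h=\mathcal{P}_1(\mathcal{T}_h;\mathbb{R}^n)\cap\boldsymbol{V}$, and $(Q_{t,h},s_h)$ is one of the following two, with $\gamma_2>0$ a parameter depending on the shape regularity of the meshes: (i) $Q_{t,h}=\mathcal{P}_0(\mathcal{T}_h)$, $s_h(p,q)=\frac{\gamma_2}{2\mu}\sum_e h_e\int_e[\![p]\!]\,[\![q]\!]\,ds$, the sum running over interior edges/faces $e$, with $[\![\cdot]\!]$ the jump across $e$ and $h_e$ the size of $e$; (ii) $Q_{t,h}=\mathcal{P}_1(\mathcal{T}_h)$, $s_h(p,q)=\frac{\gamma_2}{2\mu}\sum_{T\in\mathcal{T}_h}h_T^2(\nabla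 p,\nabla q)_T$, with $h_T$ the diameter of $T$. (For variable $\mu$ the factor $1/(2\mu)$ is understood inside the integrals.) One has $|s_h(p,q)|\lesssim\|p\|_{Q_t}\|q\|_{Q_t}$ on $Q_{t,h}$, and it is a standing assumption on the stabilized method that, with $\mathcal{B}(\boldsymbol{u},p;\boldsymbol{v},q)=(2\mu\,\epsilon(\boldsymbol{u}),\epsilon(\boldsymbol{v}))+(p,\operatorname{div}\boldsymbol{v})+(\operatorname{div}\boldsymbol{u},q)-s_h(p,q)$, $$\inf_{(\boldsymbol{u},p)\in\boldsymbol{V}_h\times Q_{t,h}}\ \sup_{(\boldsymbol{v},q)\in\boldsymbol{V}_h\times Q_{t,h}}\frac{\mathcal{B}(\boldsymbol{u},p;\boldsymbol{v},q)}{(\|\boldsymbol{u}\|_{\boldsymbol{V}}+\|p\|_{Q_t})(\|\boldsymbol{v}\|_{\boldsymbol{V}}+\|q\|_{Q_t})}\ge C>0$$ with $C$ independent of $h$ and the parameters. Norms and operator. $\|\boldsymbol{v}\|_{\boldsymbol{V}_h}^2=(2\mu\,\epsilon(\boldsymbol{v}),\epsilon(\boldsymbol{v}))$, $\|q_t\|_{Q_{t,h}}^2=((2\mu)^{-1}q_t,q_t)+s_h(q_t,q_t)$, $\|q_p\|_{Q_{p,h}}^2=\|q_p\|_{0,s_0}^2+(\underline{\boldsymbol{\kappa}}\nabla q_p,\nabla q_p)$. $\mathcal{X}_h=\boldsymbol{V}_h\times Q_{t,h}\times Q_{p,h}$ with $\|(\boldsymbol{v},q_t,q_p)\|_{\mathcal{X}_h}^2=\|\boldsymbol{v}\|_{\boldsymbol{V}_h}^2+\|q_t\|_{Q_{t,h}}^2+\|q_p\|_{Q_{p,h}}^2$.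 $\mathcal{A}:\mathcal{X}_h\to\mathcal{X}_h^*$ is the linear operator $$\langle\mathcal{A}(\boldsymbol{u},p_t,p_p),(\boldsymbol{v},q_t,q_p)\rangle_{(\mathcal{X}_h^*,\mathcal{X}_h)}=(2\mu\,\epsilon(\boldsymbol{u}),\epsilon(\boldsymbol{v}))+(p_t,\operatorname{div}\boldsymbol{v})+(\operatorname{div}\boldsymbol{u},q_t)-s_h(p_t,q_t)-(\lambda^{-1}p_t,q_t)-(\alpha\lambda^{-1}p_p,q_t)$$ $$-(\alpha\lambda^{-1}p_t,q_p)-((s_0+\alpha^2\lambda^{-1})p_p,q_p)-(\underline{\boldsymbol{\kappa}}\nabla p_p,\nabla q_p).$$ *)

(* Defs.v *)
From HB Require Import structures.
From mathcomp Require Import all_boot all_order all_algebra.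
(* The notations of mpoly clash with those of mathcomp-analysis. *)
From mathcomp Require Import -(notations) mpoly.
From mathcomp Require Import all_classical all_reals all_analysis measurable_realfun.
Set Implicit Arguments.
Unset Strict Implicit.
Unset Printing Implicit Defensive.
Import Order.TTheory GRing.Theory Num.Theory numFieldNormedType.Exports.
Local Open Scope classical_set_scope.
Local Open Scope ring_scope.

Section lebesgue_tuple.
Variable R : realType.
Let T := measurableTypeR R.

Definition tcons n (p : T * n.-tuple T) : n.+1.-tuple T := [tuple of p.1 :: p.2].

Definition tuncons n (t : n.+1.-tuple T) : T * n.-tuple T :=
  (thead t, [tuple of behead t]).

Lemma measurable_tcons n : measurable_fun [set: T * n.-tuple T] (@tcons n).
Proof. exact: (measurable_cons measurable_fst measurable_snd). Qed.

Lemma measurable_tuncons n : measurable_fun [set: n.+1.-tuple T] (@tuncons n).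
Proof.
by apply/measurable_fun_pairP; split;
  [exact: measurable_tnth | exact: measurable_behead].
Qed.

Lemma tconsK n : cancel (@tcons n) (@tuncons n).
Proof. by case=> x t; rewrite /tuncons theadE; congr (_, _); exact: val_inj. Qed.

Lemma tunconsK n : cancel (@tuncons n) (@tcons n).
Proof. by move=> t; rewrite /tcons/= [RHS]tuple_eta; exact: val_inj. Qed.

Section step.
Variables (n : nat) (m : {sigma_finite_measure set (n.-tuple T) -> \bar R}).

Definition lebesgue_step : set (n.+1.-tuple T) -> \bar R :=
  pushforward (lebesgue_measure \x m)%E (@tcons n).

Let step0 : lebesgue_step set0 = 0%E.
Proof. by rewrite /lebesgue_step /pushforward preimage_set0 measure0. Qed.

Let step_ge0 A : (0 <= lebesgue_step A)%E.
Proof. by rewrite /lebesgue_step /pushforward measure_ge0. Qed.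

Let step_sigma_additive : semi_sigma_additive lebesgue_step.
Proof.
move=> F mF tF mUF; rewrite /lebesgue_step /pushforward preimage_bigcup.
apply: measure_semi_sigma_additive.
- by move=> i; rewrite -[_ @^-1` _]setTI; exact: measurable_tcons.
- by apply/trivIsetP => i j _ _ ij; rewrite -preimage_setI;
    move/trivIsetP : tF => /(_ _ _ _ _ ij) ->//; rewrite preimage_set0.
- by rewrite -preimage_bigcup -[_ @^-1` _]setTI; exact: measurable_tcons.
Qed.

HB.instance Definition _ := isMeasure.Build _ _ _ lebesgue_step
  step0 step_ge0 step_sigma_additive.

Let step_sigma_finite : sigma_finite setT lebesgue_step.
Proof.
have /sigma_finiteP[F [TF ndF Foo]] := sigma_finiteT (@lebesgue_measure R).
have /sigma_finiteP[G [TG ndG Goo]] := sigma_finiteT m.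
exists (fun k => @tuncons n @^-1` (F k `*` G k)).
  rewrite -preimage_bigcup (_ : \bigcup_k _ = setT) ?preimage_setT//.
  rewrite -setXTT TF TG predeqE => -[x y]; split.
    by move=> [k _ []/= ? ?]; split; exists k.
  move=> [/= [i _ Fix] [k _ Gky]]; exists (maxn i k) => //; split.
  - by move: x Fix; exact/subsetPset/ndF/leq_maxl.
  - by move: y Gky; exact/subsetPset/ndG/leq_maxr.
move=> k; have [mF Fk] := Foo k; have [mG Gk] := Goo k; split.
  by rewrite -[_ @^-1` _]setTI; apply: measurable_tuncons => //; exact: measurableX.
rewrite /lebesgue_step /pushforward -comp_preimage.
rewrite (_ : _ \o _ = id); last by apply/funext => x /=; rewrite tconsK.
by rewrite preimage_id product_measure1E// lte_mul_pinfty// ge0_fin_numE.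
Qed.

HB.instance Definition _ := Measure_isSigmaFinite.Build _ _ _ lebesgue_step
  step_sigma_finite.

End step.

Fixpoint lebesgue_tuple n : {sigma_finite_measure set (n.-tuple T) -> \bar R} :=
  if n is n'.+1 then lebesgue_step (lebesgue_tuple n') else \d_([tuple] : 0.-tuple T).

End lebesgue_tuple.

Section euclidean.
Variables (R : realType) (n : nat).
Implicit Types (D S : set 'rV[R]_n) (x y : 'rV[R]_n).

Definition row_of_tuple (t : n.-tuple (measurableTypeR R)) : 'rV[R]_n :=
  \row_i (tnth t i : R).

Definition integral_on D (f : 'rV[R]_n -> R) : R :=
  \int[lebesgue_tuple R n]_(t in row_of_tuple @^-1` D) f (row_of_tuple t).

Definition measurable_on d (U : measurableType d) D (f : 'rV[R]_n -> U) : Prop :=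
  measurable_fun (row_of_tuple @^-1` D) (f \o row_of_tuple).

(* The library norm on 'rV[R]_n is the maximum norm; it has the same topology. *)
Definition dotv x y : R := \sum_i x 0 i * y 0 i.
Definition enorm x : R := Num.sqrt (dotv x x).
Definition eball x (r : R) : set 'rV[R]_n := [set y | enorm (y - x) < r].

Definition diam D : R := sup [set enorm (x - y) | x in D & y in D].
Definition inball_diam D : R :=
  sup [set 2 * r | r in [set r : R | 0 < r /\ exists c, eball c r `<=` D]].

Definition bdry D : set 'rV[R]_n := closure D `\` interior D.

Definition hull (I : finType) (a : I -> 'rV[R]_n) (s : {set I}) : set 'rV[R]_n :=
  [set x | exists w : I -> R, [/\ (forall i, i \in s -> 0 <= w i),
     \sum_(i in s) w i = 1 & x = \sum_(i in s) w i *: a i]].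

(* Null sets of the (n-1)-dimensional Hausdorff measure, which on the boundary
   of a Lipschitz domain are the null sets of the surface measure. *)
Definition surface_null S : Prop :=
  forall e : R, 0 < e -> exists (c : nat -> 'rV[R]_n) (r : nat -> R),
    [/\ (forall i, 0 < r i), S `<=` \bigcup_i eball (c i) (r i) &
        (\sum_(i <oo) ((r i) ^+ n.-1)%:E <= e%:E)%E].

(* Near a boundary point the domain is the strict subgraph, in a direction nu,
   of a Lipschitz function on the hyperplane orthogonal to nu; that function is
   extended to be constant along nu. *)
Definition lipschitz_boundary D : Prop :=
  forall x, bdry D x -> exists (r L : R) (nu : 'rV[R]_n) (phi : 'rV[R]_n -> R),
    [/\ 0 < r /\ enorm nu = 1,
        (forall y z, `|phi y - phi z| <= L * enorm (y - z)),
        (forall y t, phi (y + t *: nu) = phi y) &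
        (forall y, eball x r y -> (D y <-> dotv y nu < phi y))].

Definition polyhedral D : Prop :=
  exists (N : nat) (a : 'I_N -> 'I_n.+1 -> 'rV[R]_n),
    closure D = \bigcup_i hull (a i) [set: 'I_n.+1]%SET.

Definition polyhedral_lipschitz_domain D : Prop :=
  [/\ open D, connected D, bounded_set D, polyhedral D & lipschitz_boundary D].

Definition boundary_partition D (G1 G2 : set 'rV[R]_n) : Prop :=
  G1 `|` G2 = bdry D /\ G1 `&` G2 = set0.

End euclidean.

Section meshes.
Variables (R : realType) (n : nat).

(* A cell, like a face, is the set of the nodes that are its vertices. *)
Record mesh := Mesh {
  nnodes : nat;
  node : 'I_nnodes -> 'rV[R]_n;
  ncells : nat;
  cell : 'I_ncells -> {set 'I_nnodes} }.

Variable m : mesh.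
Implicit Types (s e : {set 'I_(nnodes m)}).

Definition simplex s : set 'rV[R]_n := hull (@node m) s.

Definition vertex s (i : nat) : 'rV[R]_n :=
  nth 0 [seq node z | z <- enum s] i.

Definition edges k s : 'M[R]_(k, n) :=
  \matrix_(i < k) (vertex s i.+1 - vertex s 0).

Definition triangulation (Om : set 'rV[R]_n) : Prop :=
  [/\ injective (@node m) /\ injective (@cell m),
      (forall i, #|cell i| = n.+1 /\ edges n (cell i) \in unitmx),
      closure Om = \bigcup_(i in [set: 'I_(ncells m)]) simplex (cell i) &
      (forall i j : 'I_(ncells m), simplex (cell i) `&` simplex (cell j) =
         simplex (cell i :&: cell j))].

Definition shape_regular (sigma : R) : Prop :=
  forall i : 'I_(ncells m),
    diam (simplex (cell i)) <= sigma * inball_diam (simplex (cell i)).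

Definition interior_face e : bool :=
  (#|e| == n) && [exists i : 'I_(ncells m), exists j : 'I_(ncells m),
                    (i != j) && (cell i :&: cell j == e)%SET].

Definition reference_simplex k : set 'rV[R]_k :=
  [set t | (forall i, 0 <= t 0 i) /\ \sum_i t 0 i <= 1].

(* Surface integral over the face e, computed in the affine parametrization of e
   by the reference simplex. *)
Definition face_integral e (f : 'rV[R]_n -> R) : R :=
  let J := edges n.-1 e in
  Num.sqrt (\det (J *m J^T)) *
  integral_on (@reference_simplex n.-1) (fun t => f (vertex e 0 + t *m J)).

Definition mesh_integral (f : 'I_(ncells m) -> 'rV[R]_n -> R) : R :=
  \sum_i integral_on (simplex (cell i)) (f i).

(* A piecewise polynomial is given by its polynomial on each cell. *)
Definition pwpoly := {ffun 'I_(ncells m) -> mpoly n R}.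
Definition pwpolyv := {ffun 'I_n -> pwpoly}.
Implicit Types (p q : pwpoly) (u v : pwpolyv).

Definition pval q i (x : 'rV[R]_n) : R := meval (x 0) (q i).
Definition pgrad q i (x : 'rV[R]_n) : 'rV[R]_n :=
  \row_j meval (x 0) (mderiv j (q i)).
Definition pjac v i (x : 'rV[R]_n) : 'M[R]_n :=
  \matrix_(c, j) pgrad (v c) i x 0 j.
Definition peps v i (x : 'rV[R]_n) : 'M[R]_n :=
  2^-1 *: (pjac v i x + (pjac v i x)^T).
Definition pdiv v i (x : 'rV[R]_n) : R := \tr (pjac v i x).
Definition ddot (A B : 'M[R]_n) : R := \sum_i \sum_j A i j * B i j.

(* msize is the degree plus one (0 for the zero polynomial). *)
Definition Pk (k : nat) : set pwpoly :=
  [set q : pwpoly | (forall i, (msize (q i) <= k.+1)%N) /\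
     ((0 < k)%N -> forall i j x, simplex (cell i) x -> simplex (cell j) x ->
        pval q i x = pval q j x)].

Definition zero_trace (G : set 'rV[R]_n) (q : pwpoly) : Prop :=
  surface_null [set x | G x /\ exists i, simplex (cell i) x /\ pval q i x != 0].

(* The sign depends on the enumeration of the two cells sharing e, but products
   of jumps across e do not. *)
Definition jump q e (x : 'rV[R]_n) : R :=
  if enum [pred i : 'I_(ncells m) | e \subset cell i] is [:: i, j & _]
  then pval q i x - pval q j x else 0.

End meshes.

Inductive stabilization := JumpP0 | GradP1.

Section discretization.
Variables (R : realType) (n : nat) (m : mesh R n) (st : stabilization).
Implicit Types (u v : pwpolyv m) (p q : pwpoly m).

Definition Vh (Gd : set 'rV[R]_n) : set (pwpolyv m) :=
  [set v : pwpolyv m | forall c, Pk 1 (v c) /\ zero_trace Gd (v c)].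

Definition Qth : set (pwpoly m) :=
  match st with JumpP0 => Pk 0 | GradP1 => Pk 1 end.

Definition Qph (k : nat) (Gp : set 'rV[R]_n) : set (pwpoly m) :=
  [set q : pwpoly m | Pk k q /\ zero_trace Gp q].

Definition L2w (w : 'rV[R]_n -> R) p q : R :=
  mesh_integral (fun i x => w x * pval p i x * pval q i x).

Definition div_form v q : R :=
  mesh_integral (fun i x => pval q i x * pdiv v i x).

Variables (mu : 'rV[R]_n -> R) (gamma2 : R).

Definition elasticity u v : R :=
  mesh_integral (fun i x => 2 * mu x * ddot (peps u i x) (peps v i x)).

Definition sh p q : R :=
  match st with
  | JumpP0 => gamma2 * \sum_(e | interior_face e) diam (simplex e) *
      face_integral e (fun x => (2 * mu x)^-1 * jump p e x * jump q e x)
  | GradP1 => gamma2 * \sum_i diam (simplex (cell i)) ^+ 2 *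
      integral_on (simplex (cell i))
        (fun x => (2 * mu x)^-1 * dotv (pgrad p i x) (pgrad q i x))
  end.

Definition normV v : R := Num.sqrt (elasticity v v).
Definition normQt q : R := Num.sqrt (L2w (fun x => (2 * mu x)^-1) q q).
Definition normQth q : R :=
  Num.sqrt (L2w (fun x => (2 * mu x)^-1) q q + sh q q).

Definition stokes (x y : pwpolyv m * pwpoly m) : R :=
  elasticity x.1 y.1 + div_form y.1 x.2 + div_form x.1 y.2 - sh x.2 y.2.

Definition norm_stokes (x : pwpolyv m * pwpoly m) : R := normV x.1 + normQt x.2.

Variables (lambda : 'rV[R]_n -> \bar R) (alpha : R) (s0 : 'rV[R]_n -> R)
  (kappa : 'rV[R]_n -> 'M[R]_n).

Definition kappa_form p q : R :=
  mesh_integral (fun i x => (pgrad q i x *m kappa x *m (pgrad p i x)^T) 0 0).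

(* The inverse of +oo is 0. *)
Definition lambda_inv (x : 'rV[R]_n) : R := fine ((lambda x)^-1)%E.

Definition normQph q : R := Num.sqrt (L2w s0 q q + kappa_form q q).

Definition biot_space := (pwpolyv m * pwpoly m * pwpoly m)%type.

Definition norm_biot (x : biot_space) : R :=
  Num.sqrt (normV x.1.1 ^+ 2 + normQth x.1.2 ^+ 2 + normQph x.2 ^+ 2).

(* The duality pairing of A x with y. *)
Definition biot (x y : biot_space) : R :=
  let: (u, pt, pp) := x in let: (v, qt, qp) := y in
  elasticity u v + div_form v pt + div_form u qt - sh pt qt
  - L2w lambda_inv pt qt - L2w (fun z => alpha * lambda_inv z) pp qt
  - L2w (fun z => alpha * lambda_inv z) pt qp
  - L2w (fun z => s0 z + alpha ^+ 2 * lambda_inv z) pp qp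
  - kappa_form pp qp.

End discretization.

Definition infsup (R : realType) (X : zmodType) (S : set X) (b : X -> X -> R)
    (N : X -> R) : \bar R :=
  ereal_inf [set ereal_sup [set (b x y / (N x * N y))%:E | y in [set y | S y /\ y != 0]]
            | x in [set x | S x /\ x != 0]].

(* Main.v *)
Require Import Defs.
From HB Require Import structures.
From mathcomp Require Import all_boot all_order all_algebra.
From mathcomp Require Import -(notations) mpoly.
From mathcomp Require Import all_classical all_reals all_analysis measurable_realfun.
From mathcomp Require perm.
From mathcomp Require Import ring lra.
Import Order.TTheory GRing.Theory Num.Theory numFieldNormedType.Exports.
Local Open Scope classical_set_scope.
Local Open Scope ring_scope.

(** The quantity to bound from below is the supremum of the form over test functions,
    relative to the product of the norms. Two test functions suffice for each
    (u, pt, pp).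

    The first is (u, - pt, - pp). It turns the form into the energy
    elasticity u u + sh pt pt + |pp|^2 + E, where E is the square of the norm of
    pt + alpha pp with weight 1 / lambda (lemmas [biot_energy] and
    [coupling_energyE]). The energy controls all the parts of the norm but the mass
    of pt. If it is at least a fixed fraction of the squared norm, this test function
    gives the inf-sup bound.

    Otherwise most of the squared norm is the mass of pt, and E is small. The inf-sup
    condition of the stabilized Stokes problem then provides (v, q), and the second
    test function is (v, q, 0). The form differs from the Stokes form by the product
    of pt + alpha pp with q, with weight 1 / lambda. By Young's inequality this is at
    most a small multiple of the product of the norms: E is small, and 1 / lambda is
    dominated by 1 / mu, up to a constant, because mu is bounded by a multiple of
    lambda (lemmas [coupling_young], [lambda_inv_le] and [biot_infsup]).

    Two facts about meshes are needed. The norm of (v, q) in the Stokes condition does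
    not contain sh q q, so this has to be bounded by the mass of q uniformly in the
    mesh. That inverse estimate compares integrals over a cell with volumes of boxes:
    by shape regularity a cell of diameter h contains a box of side comparable with h
    and lies in a box of side 2 h (lemmas [sh_jump_le] and [sh_grad_le]). Moreover
    the quotient in the inf-sup condition is 0 where a norm vanishes, so the norm has
    to be definite. For u and pt this follows from the Stokes condition itself. For pp
    a vanishing norm makes the gradient vanish, first as a function and then as a
    polynomial; connectedness makes pp constant, and the boundary condition on a set
    that is not null makes it 0 (lemma [Qph_definite]). *)

Set Implicit Arguments.
Unset Strict Implicit.
Unset Printing Implicit Defensive.

(** * Integrals of nonnegative functions and measures of boxes *)

(** When one of the two parts of f has an infinite integral, both sides are the
    finite part of an infinity, that is 0; otherwise f and - f exchange their
    parts. *)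
Lemma RintegralN_total d (T : measurableType d) (R : realType)
    (mu : {measure set T -> \bar R}) (D : set T) (f : T -> R) :
  \int[mu]_(x in D) (- f x) = - \int[mu]_(x in D) f x.
Proof.
rewrite /Rintegral integralE [in RHS]integralE.
have -> : (fun x => (- f x)%:E) = (\- (EFin \o f))%E by [].
rewrite funeposN funenegN.
set a := (\int[mu]_(x in D) _ x)%E; set b := (\int[mu]_(x in D) _ x)%E.
have a0 : (0 <= a)%E by apply: integral_ge0 => x _; exact: funeneg_ge0.
have b0 : (0 <= b)%E by apply: integral_ge0 => x _; exact: funepos_ge0.
move: a0 b0; case: a => [a| |] //; case: b => [b| |] //= _ _; rewrite ?oppr0 //.
by rewrite opprB.
Qed.

(** The integral of a nonnegative function is a supremum over the simple functions
    below it, so it increases with the function. It serves for weights restricted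
    to faces, of which only the values are controlled. *)
Lemma ge0_le_integral_total d (T : measurableType d) (R : realType)
    (mu : {measure set T -> \bar R}) (D : set T) (f g : T -> \bar R) :
  (forall x, D x -> 0 <= f x)%E -> (forall x, D x -> f x <= g x)%E ->
  (\int[mu]_(x in D) f x <= \int[mu]_(x in D) g x)%E.
Proof.
move=> f0 fg; rewrite !ge0_integralE//; last first.
  by move=> x Dx; apply: le_trans (fg _ Dx); exact: f0.
apply: ereal_sup_le => _ [h hf <-].
by exists h => // x; apply: le_trans (hf x) _; apply: lee_restrict.
Qed.

Section boxes.
Variables (R : realType).
Local Notation T := (measurableTypeR R).

Definition box n (a b : 'rV[R]_n) : set 'rV[R]_n :=
  [set x | forall i, a 0 i <= x 0 i <= b 0 i].

Lemma measurable_coord n (i : 'I_n) D :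
  measurable_fun D (fun t : n.-tuple T => (row_of_tuple t 0 i : R)).
Proof.
apply: (@measurable_funS _ _ _ _ setT) => //.
rewrite (_ : (fun _ => _) = (fun t : n.-tuple T => tnth t i)); first exact: measurable_tnth.
by apply/funext => t; rewrite mxE.
Qed.

Lemma measurable_box n (a b : 'rV[R]_n) : measurable (@row_of_tuple R n @^-1` box a b).
Proof.
have -> : @row_of_tuple R n @^-1` box a b =
  \bigcap_(i in [set: 'I_n]) ((fun t : n.-tuple T => (row_of_tuple t 0 i : R)) @^-1`
     [set` `[a 0 i, b 0 i]]).
  by apply/seteqP; split => t /= h i => [_|]; have := h i; rewrite /= in_itv /= => H; apply: H.
apply: fin_bigcap_measurable; first exact: finite_finset.
move=> i _; rewrite -[_ @^-1` _]setTI.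
by apply: measurable_coord => //; exact: measurable_itv.
Qed.

(** By construction of the measure, removing the first coordinate turns the box
    into the product of an interval and a box of one dimension less. *)
Lemma lebesgue_box n (a b : 'rV[R]_n) : (forall i, a 0 i <= b 0 i) ->
  lebesgue_tuple R n (@row_of_tuple R n @^-1` box a b) =
  (\prod_(i < n) (b 0 i - a 0 i))%:E.
Proof.
elim: n a b => [|n IH] a b ab.
  rewrite big_ord0 /= /dirac indicE.
  by rewrite mem_set// => -[].
pose a' : 'rV[R]_n := \row_i a 0 (lift ord0 i).
pose b' : 'rV[R]_n := \row_i b 0 (lift ord0 i).
rewrite /= /lebesgue_step /pushforward.
have -> : tcons (n:=n) @^-1` (@row_of_tuple R n.+1 @^-1` box a b) =
  [set` `[a 0 0, b 0 0]] `*` (@row_of_tuple R n @^-1` box a' b').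
  apply/seteqP; split => -[x t] /=.
    move=> h; split.
      by have := h 0; rewrite mxE /= in_itv.
    by move=> i; have := h (lift ord0 i); rewrite !mxE tnthS.
  move=> [h1 h2] i; case: (unliftP ord0 i) => [j ->|->].
    by have := h2 j; rewrite !mxE tnthS.
  by move: h1; rewrite mxE /= in_itv.
rewrite product_measure1E; [|exact: measurable_itv|exact: measurable_box].
rewrite IH; last by move=> i; rewrite !mxE.
rewrite big_ord_recl EFinM; congr (_ * _)%E.
  have := lebesgue_measure_itv `[a 0 0, b 0 0]; rewrite /= => ->; rewrite lte_fin -EFinB.
  by have := ab 0; rewrite le_eqVlt => /predU1P[->|->//]; rewrite ltxx subrr.
by congr EFin; apply: eq_bigr => i _; rewrite !mxE.
Qed.

Lemma lebesgue_box_lty n (a b : 'rV[R]_n) :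
  (lebesgue_tuple R n (@row_of_tuple R n @^-1` box a b) < +oo)%E.
Proof.
have [/forallP ab|] := boolP [forall i, a 0 i <= b 0 i].
  by rewrite lebesgue_box// ltry.
rewrite negb_forall => /existsP[i /negP nab].
rewrite (_ : box a b = set0) ?preimage_set0 ?measure0//.
by apply/seteqP; split => // x /(_ i)/andP[h1 h2]; apply: nab; apply: le_trans h2.
Qed.

End boxes.

(** * Polynomials in several variables *)

Section polynomials.
Variables (R : realType) (n : nat).
Implicit Types (p : mpoly n R).

Lemma horner_mmap (h : 'I_n -> {poly R}) p t :
  (mmap (@polyC R) h p).[t] = meval (fun i => (h i).[t]) p.
Proof.
rewrite /meval /mmap horner_sum; apply: eq_bigr => m _.
rewrite hornerM hornerC /mmap1 horner_prod; congr (_ * _).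
by apply: eq_bigr => i _; rewrite horner_exp.
Qed.

(** The points e / 2, e / 3, ... are more roots than the degree allows. *)
Lemma poly_vanishing_near0 (q : {poly R}) (e : R) : 0 < e ->
  (forall t, `|t| < e -> q.[t] = 0) -> q = 0.
Proof.
move=> e0 hq; apply/eqP; apply: contraT => q0.
pose s := [seq e / (i.+2)%:R | i <- iota 0 (size q)].
suff /(max_poly_roots q0) : all (root q) s.
  move=> /(_ _); rewrite size_map size_iota ltnn; apply.
  rewrite map_inj_in_uniq ?iota_uniq// => i j _ _ /(mulfI (lt0r_neq0 e0)) /invr_inj /eqP.
  by rewrite eqr_nat => /eqP [].
apply/allP => _ /mapP[i _ ->]; apply/rootP/hq.
rewrite ger0_norm ?divr_ge0 ?ltW// ltr_pdivrMr// ltr_pMr//.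
by rewrite ltr1n.
Qed.

(** Along the line through the centre and x, the polynomial has one variable and
    vanishes near 0, hence everywhere. *)
Lemma mpoly_vanishing_ball p (c : 'I_n -> R) (a : R) : 0 < a ->
  (forall x : 'I_n -> R, (forall i, `|x i - c i| < a) -> meval x p = 0) ->
  forall x, meval x p = 0.
Proof.
move=> a0 hp x.
pose h i := (c i)%:P + (x i - c i) *: 'X.
have hh t i : (h i).[t] = c i + (x i - c i) * t.
  by rewrite hornerD hornerC hornerZ hornerX.
pose M := 1 + \sum_i `|x i - c i|.
have M0 : 0 < M by rewrite ltr_pwDl// sumr_ge0.
have q0 : mmap (@polyC R) h p = 0.
  apply: (@poly_vanishing_near0 _ (a / M)); first by rewrite divr_gt0.
  move=> t ht; rewrite horner_mmap; apply: hp => i.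
  rewrite hh addrAC subrr add0r normrM.
  move: ht; rewrite ltr_pdivlMr//; apply: le_lt_trans.
  rewrite mulrC ler_wpM2l// /M (bigD1 i)//= addrCA lerDl addr_ge0// sumr_ge0//.
have := horner_mmap h p 1; rewrite q0 horner0 => ->; apply: meval_eq => i.
by rewrite hh mulr1 addrC subrK.
Qed.

End polynomials.

(** The uniqueness of the digits in base N makes the substitution of 'X^(N ^ i) for
    the i-th variable injective on the monomials of small degree. *)
Lemma digits_inj (N n : nat) (f g : 'I_n -> nat) :
  (forall i, f i < N)%N -> (forall i, g i < N)%N ->
  (\sum_i f i * N ^ i = \sum_i g i * N ^ i)%N -> f =1 g.
Proof.
elim: n f g => [|n IH] f g hf hg; first by move=> _ [].
rewrite !big_ord_recl /= !expn0 !muln1.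
have E h : (\sum_(i < n) h (lift ord0 i) * N ^ bump 0 i =
            N * \sum_(i < n) h (lift ord0 i) * N ^ i)%N.
  by rewrite big_distrr; apply: eq_bigr => i _; rewrite /= /bump /= add1n expnS mulnCA.
rewrite (E f) (E g) => H.
have N0 : (0 < N)%N by apply: leq_ltn_trans (hf ord0).
have H0 : f ord0 = g ord0.
  have := congr1 (modn^~ N) H.
  by rewrite ![(_ + N * _)%N]addnC !(mulnC N) !modnMDl !modn_small.
move: H; rewrite H0 => /addnI /eqP; rewrite eqn_pmul2l// => /eqP H i.
case: (unliftP ord0 i) => [j ->|->//].
exact: (IH (fun i => f (lift ord0 i)) (fun i => g (lift ord0 i))).
Qed.

Section polynomial_identity.
Variables (R : realType) (n : nat).
Implicit Types (p : mpoly n R).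

(** Substituting 'X^(N ^ i) for the i-th variable, with N above all the exponents
    (Kronecker's substitution), gives a polynomial in one variable that has the
    same coefficients and vanishes everywhere. *)
Lemma mpoly_vanishing_eq0 p : (forall x, meval x p = 0) -> p = 0.
Proof.
move=> hp; set N := msize p.
have hN (m : multinom n) i : m \in msupp p -> (m i < N)%N.
  move=> mp; apply: leq_ltn_trans (msize_mdeg_lt mp).
  by rewrite mdegE (bigD1 i)//= leq_addr.
have q0 : mmap (@polyC R) (fun i : 'I_n => 'X^(N ^ i)) p = 0.
  apply: (@poly_vanishing_near0 _ _ 1) => // t _.
  by rewrite horner_mmap hp.
apply/mpolyP => m0; rewrite mcoeff0.
have [m0p|] := boolP (m0 \in msupp p); last by rewrite mcoeff_msupp negbK => /eqP.
have := congr1 (fun q : {poly R} => q`_(\sum_i m0 i * N ^ i)%N) q0.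
rewrite coef0 /mmap coef_sum (bigD1_seq m0)//=.
have E m : mmap1 (fun i : 'I_n => 'X^(N ^ i)) m = 'X^(\sum_i m i * N ^ i)%N :> {poly R}.
  rewrite (@big_morph _ _ (fun k => 'X^k : {poly R}) _ _ _ _ (@exprD _ 'X) (expr0 _)).
  by apply: eq_bigr => i _; rewrite -exprM mulnC.
rewrite E mul_polyC coefZ coefXn eqxx mulr1 [X in _ + X]big1_seq ?addr0//.
move=> m /andP[mm0 mp]; rewrite E mul_polyC coefZ coefXn.
case: eqP => [H|_]; last by rewrite mulr0.
have /mnmP mE : m0 =1 m by apply: (@digits_inj N) => // i; exact: hN.
by rewrite mE eqxx in mm0.
Qed.

(** A coefficient of positive degree reappears, multiplied by a positive integer, in
    some partial derivative. *)
Lemma mderiv_eq0_const p : (forall j, mderiv j p = 0) -> p = mpolyC n (mcoeff (@mnm0 n) p).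
Proof.
move=> hp; apply/mpolyP => m; rewrite mcoeffC.
have [->|m0] := eqVneq m (@mnm0 n); first by rewrite mulr1.
have [j mj] : exists j, m j != 0%N.
  apply/existsP; rewrite -negb_forall; apply: contra m0 => /forallP h.
  by apply/eqP/mnmP => i; rewrite mnm0E; exact/eqP.
have mE : m = mnm_add (mnm_sub m (mnm1 j)) (mnm1 j) by rewrite submK// lep1mP.
have /eqP := congr1 (mcoeff (mnm_sub m (mnm1 j))) (hp j).
rewrite mcoeff_mderiv mcoeff0 -mE mulrn_eq0 /= => /eqP ->.
by rewrite mulr0.
Qed.

(** The derivatives are constant, so that their point of evaluation z is arbitrary.
    The identity is linear in the polynomial and is checked on monomials of degree
    at most one. *)
Lemma meval_affine p (x y z : 'I_n -> R) : (msize p <= 2)%N ->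
  meval y p = meval x p + \sum_j (y j - x j) * meval z (mderiv j p).
Proof.
move=> hp; pose P (q : mpoly n R) :=
  meval y q = meval x q + \sum_j (y j - x j) * meval z (mderiv j q).
rewrite -/(P p) (mpolyE p).
have : forall m, m \in msupp p -> (mdeg m <= 1)%N.
  by move=> m /msize_mdeg_lt h; rewrite -ltnS; apply: leq_trans hp.
elim: (msupp p : seq _) => [|m s IH] h.
  rewrite big_nil /P !meval0 big1 ?addr0// => j _.
  by rewrite mderiv0 meval0 mulr0.
rewrite big_cons; set q := \sum_(i <- s) _ in IH *.
suff hm : P (mpolyX R m).
  have hq : P q by apply: IH => m' m's; apply: h; rewrite inE m's orbT.
  rewrite /P !mevalD !mevalZ hm hq mulrDr addrACA; congr (_ + _).
  rewrite mulr_sumr -big_split /=; apply: eq_bigr => j _.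
  by rewrite mderivD mevalD mderivZ mevalZ; ring.
rewrite /P; have : (mdeg m <= 1)%N by apply: h; rewrite mem_head.
rewrite leq_eqVlt ltnS leqn0 mdeg_eq0 => /orP[|/eqP ->]; last first.
  rewrite mpolyX0 !meval1 big1 ?addr0// => j _.
  by rewrite -[1]mpolyC1 mderivC meval0 !mulr0.
rewrite -[mdeg m == 1%N]/(_) => /eqP m1.
have [i /eqP ->] : exists i, m == mnm1 i by apply/existsP; rewrite -mdeg_eq1 m1.
rewrite !mevalXU (bigD1 i)//= big1 => [|j ji].
  rewrite mderivX mnm1E eqxx scale1r.
  have -> : mnm_sub (mnm1 i) (mnm1 i) = (@mnm0 n) :> multinom n by apply/mnmP => j; rewrite mnmBE subnn mnm0E.
  by rewrite mpolyX0 meval1; ring.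
by rewrite mderivX mnm1E eq_sym (negbTE ji) scale0r meval0 !mulr0.
Qed.

End polynomial_identity.

(** * Integrals of bounded measurable functions *)

Section integrals.
Variables (R : realType) (n : nat).
Implicit Types (D A : set 'rV[R]_n) (f g : 'rV[R]_n -> R) (x y : 'rV[R]_n).
Local Notation T := (n.-tuple (measurableTypeR R)).
Local Notation leb := (lebesgue_tuple R n).
Local Notation pre D := (@row_of_tuple R n @^-1` D).

Definition bounded_meas_set D := measurable (pre D) /\ exists a b, D `<=` box a b.

(** On a bounded measurable set these functions are integrable, and they form a ring
    that contains the polynomials and the coefficients of the problem: this one
    class provides all the integrability conditions. *)
Definition bounded_meas D f := measurable_on D f /\ exists M, forall x, D x -> `|f x| <= M.

Lemma lebesgue_bounded D : bounded_meas_set D -> (leb (pre D) < +oo)%E.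
Proof.
move=> [mD [a [b Dab]]]; apply: le_lt_trans (lebesgue_box_lty a b).
by apply: le_measure; rewrite ?inE//; [exact: measurable_box|move=> t; exact: Dab].
Qed.

Lemma bounded_meas_eq D f g : (forall x, D x -> f x = g x) -> bounded_meas D f -> bounded_meas D g.
Proof.
move=> fg [mf [M fM]]; split.
  apply: eq_measurable_fun mf => t; rewrite inE => Dt /=; exact: fg.
by exists M => x Dx; rewrite -fg//; exact: fM.
Qed.

Lemma bounded_meas_cst D (c : R) : bounded_meas D (fun=> c).
Proof. by split; [exact: measurable_cst|exists `|c|]. Qed.

Lemma bounded_measD D f g : bounded_meas D f -> bounded_meas D g -> bounded_meas D (fun x => f x + g x).
Proof.
move=> [mf [M fM]] [mg [N gN]]; split; first exact: measurable_funD.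
exists (M + N) => x Dx; apply: le_trans (ler_normD _ _) _.
by rewrite lerD ?fM ?gN.
Qed.

Lemma bounded_measM D f g : bounded_meas D f -> bounded_meas D g -> bounded_meas D (fun x => f x * g x).
Proof.
move=> [mf [M fM]] [mg [N gN]]; split; first exact: measurable_funM.
by exists (M * N) => x Dx; rewrite normrM ler_pM ?fM ?gN.
Qed.

Lemma bounded_meas_sum D I (r : seq I) (F : I -> 'rV[R]_n -> R) :
  (forall i, bounded_meas D (F i)) -> bounded_meas D (fun x => \sum_(i <- r) F i x).
Proof.
move=> hF; elim: r => [|i r IH].
  by apply: (@bounded_meas_eq _ (fun=> 0)); [move=> x _; rewrite big_nil|exact: bounded_meas_cst].
apply: (@bounded_meas_eq _ (fun x => F i x + \sum_(i <- r) F i x)); last exact: bounded_measD.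
by move=> x _; rewrite big_cons.
Qed.

Lemma bounded_meas_prod D I (r : seq I) (F : I -> 'rV[R]_n -> R) :
  (forall i, bounded_meas D (F i)) -> bounded_meas D (fun x => \prod_(i <- r) F i x).
Proof.
move=> hF; elim: r => [|i r IH].
  by apply: (@bounded_meas_eq _ (fun=> 1)); [move=> x _; rewrite big_nil|exact: bounded_meas_cst].
apply: (@bounded_meas_eq _ (fun x => F i x * \prod_(i <- r) F i x)); last exact: bounded_measM.
by move=> x _; rewrite big_cons.
Qed.

Lemma bounded_measX D f k : bounded_meas D f -> bounded_meas D (fun x => f x ^+ k).
Proof.
move=> hf; elim: k => [|k IH]; first exact: (bounded_meas_cst D 1).
by apply: bounded_meas_eq (bounded_measM hf IH) => x _; rewrite exprS.
Qed.

Lemma bounded_meas_coord D i : bounded_meas_set D -> bounded_meas D (fun x => x 0 i).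
Proof.
move=> [_ [a [b Dab]]]; split; first exact: measurable_coord.
exists (`|a 0 i| + `|b 0 i|) => x /Dab/(_ i)/andP[h1 h2].
have := ler_norm (- a 0 i); have := ler_norm (b 0 i); rewrite normrN.
by have := normr_ge0 (a 0 i); have := normr_ge0 (b 0 i); rewrite ler_norml; lra.
Qed.

Lemma bounded_meas_meval D (p : mpoly n R) : bounded_meas_set D ->
  bounded_meas D (fun x => meval (x 0) p).
Proof.
move=> bD; apply: (@bounded_meas_eq _ (fun x => \sum_(m <- msupp p)
   mcoeff m p * \prod_(i <- index_enum 'I_n) x 0 i ^+ m i)).
  by move=> x _; rewrite mevalE.
apply: bounded_meas_sum => m; apply: bounded_measM; first exact: bounded_meas_cst.
by apply: bounded_meas_prod => i; apply: bounded_measX; exact: bounded_meas_coord.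
Qed.

Lemma bounded_meas_integrable D f : bounded_meas_set D -> bounded_meas D f ->
  leb.-integrable (pre D) (EFin \o (f \o @row_of_tuple R n)).
Proof.
move=> bD [mf [M fM]]; apply: measurable_bounded_integrable => //.
- by case: bD.
- exact: lebesgue_bounded.
exists M; split; first exact: num_real.
move=> N MN t /= Dt; apply: le_trans (ltW MN); exact: fM.
Qed.

Lemma integral_onN D f : integral_on D (fun x => - f x) = - integral_on D f.
Proof. exact: RintegralN_total. Qed.

Lemma integral_on_ge0 D f : (forall x, D x -> 0 <= f x) -> 0 <= integral_on D f.
Proof. by move=> f0; apply: Rintegral_ge0 => t Dt; exact: f0. Qed.

Lemma eq_integral_on D f g : (forall x, D x -> f x = g x) ->
  integral_on D f = integral_on D g.
Proof. by move=> fg; apply: eq_Rintegral => t; rewrite inE => Dt; exact: fg. Qed.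

Lemma integral_onD D f g : bounded_meas_set D -> bounded_meas D f -> bounded_meas D g ->
  integral_on D (fun x => f x + g x) = integral_on D f + integral_on D g.
Proof.
by move=> bD hf hg; apply: RintegralD; [case: bD|exact: bounded_meas_integrable..].
Qed.

Lemma integral_onZ D f c : bounded_meas_set D -> bounded_meas D f ->
  integral_on D (fun x => c * f x) = c * integral_on D f.
Proof.
by move=> bD hf; apply: RintegralZl; [case: bD|exact: bounded_meas_integrable].
Qed.

Lemma le_integral_on D f g : bounded_meas_set D -> bounded_meas D f -> bounded_meas D g ->
  (forall x, D x -> f x <= g x) -> integral_on D f <= integral_on D g.
Proof.
move=> bD hf hg fg; apply: le_Rintegral; [by case: bD|exact: bounded_meas_integrable..|].
by move=> t Dt; exact: fg.
Qed.

Lemma integral_on_le_cst D f M a b : measurable (pre D) -> D `<=` box a b ->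
  (forall i, a 0 i <= b 0 i) -> (forall x, D x -> 0 <= f x <= M) -> 0 <= M ->
  integral_on D f <= M * \prod_i (b 0 i - a 0 i).
Proof.
move=> mD Dab ab fM M0; rewrite /integral_on /Rintegral.
have lab := lebesgue_box ab.
have lD : (leb (pre D) <= (\prod_i (b 0 i - a 0 i))%:E)%E.
  by rewrite -lab; apply: le_measure; rewrite ?inE//;
    [exact: measurable_box|move=> t; exact: Dab].
have h : (\int[leb]_(t in pre D) (f (row_of_tuple t))%:E
    <= (M * \prod_i (b 0 i - a 0 i))%:E)%E.
  apply: (@le_trans _ _ (\int[leb]_(t in pre D) (cst M%:E t))%E).
    by apply: ge0_le_integral_total => t Dt; rewrite lee_fin; have /andP[] := fM _ Dt.
  by rewrite integral_cst// EFinM lee_wpmul2l// lee_fin.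
rewrite -lee_fin fineK// ge0_fin_numE.
  by apply: le_lt_trans h _; rewrite ltry.
by apply: integral_ge0 => t Dt; rewrite lee_fin; have /andP[] := fM _ Dt.
Qed.

(** Together with the previous lemma, this compares integrals over a simplex with
    volumes of boxes inside and outside of it. *)
Lemma integral_on_ge_cst D f m a b : bounded_meas_set D -> bounded_meas D f ->
  box a b `<=` D -> (forall i, a 0 i <= b 0 i) ->
  (forall x, D x -> 0 <= f x) -> (forall x, box a b x -> m <= f x) -> 0 <= m ->
  m * \prod_i (b 0 i - a 0 i) <= integral_on D f.
Proof.
move=> bD hf abD ab f0 fm m0.
have lab := lebesgue_box ab.
have fin : (\int[leb]_(t in pre D) (f (row_of_tuple t))%:E)%E \is a fin_num.
  by apply: integrable_fin_num; [case: bD|exact: bounded_meas_integrable].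
rewrite -lee_fin /integral_on /Rintegral fineK// EFinM -lab.
rewrite -integral_cst; last exact: measurable_box.
apply: (@le_trans _ _ (\int[leb]_(t in pre (box a b)) (f (row_of_tuple t))%:E)%E).
  by apply: ge0_le_integral_total => t /= abt; rewrite lee_fin//; exact: fm.
apply: ge0_subset_integral => //.
- exact: measurable_box.
- by case: bD.
- by apply/measurable_EFinP; case: hf.
- by move=> t Dt; rewrite lee_fin; exact: f0.
- by move=> t; exact: abD.
Qed.

Lemma continuous_coord i : continuous (fun x : 'rV[R]_n => x 0 i).
Proof. exact: coord_continuous. Qed.

Lemma continuousD_fun f g : continuous f -> continuous g -> continuous (fun x => f x + g x).
Proof. by move=> cf cg x; exact: (@cvgD _ R^o _ _ _ _ _ _ _ (cf x) (cg x)). Qed.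

Lemma continuousM_fun f g : continuous f -> continuous g -> continuous (fun x => f x * g x).
Proof. by move=> cf cg x; exact: (cvgM (cf x) (cg x)). Qed.

Lemma continuous_sum I (r : seq I) (F : I -> 'rV[R]_n -> R) :
  (forall i, continuous (F i)) -> continuous (fun x => \sum_(i <- r) F i x).
Proof.
move=> cF; elim: r => [|i r IH]; first by under eq_fun do rewrite big_nil; exact: cst_continuous.
by under eq_fun do rewrite big_cons; exact: continuousD_fun.
Qed.

Lemma continuous_prod I (r : seq I) (F : I -> 'rV[R]_n -> R) :
  (forall i, continuous (F i)) -> continuous (fun x => \prod_(i <- r) F i x).
Proof.
move=> cF; elim: r => [|i r IH]; first by under eq_fun do rewrite big_nil; exact: cst_continuous.
by under eq_fun do rewrite big_cons; exact: continuousM_fun.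
Qed.

Lemma continuous_meval (p : mpoly n R) :
  continuous (fun x : 'rV[R]_n => meval (x 0) p).
Proof.
rewrite (_ : (fun _ => _) = fun y : 'rV[R]_n => \sum_(m <- msupp p)
  mcoeff m p * \prod_(i < n) y 0 i ^+ m i); last by apply/funext => y; exact: mevalE.
apply: continuous_sum => m; apply: continuousM_fun; first exact: cst_continuous.
apply: continuous_prod => i x.
apply: (@continuous_comp _ _ _ (fun x : 'rV[R]_n => x 0 i) (fun t : R => t ^+ m i)).
  exact: continuous_coord.
exact: exprn_continuous.
Qed.

End integrals.

(** Inversion is continuous away from 0, and a singleton does not affect
    measurability. *)
Lemma measurable_inv (R : realType) :
  measurable_fun setT (@GRing.inv R : measurableTypeR R -> measurableTypeR R).
Proof.
have o : open [set x : R | x != 0] by exact: open_neq.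
have mo : measurable ([set x : R | x != 0] : set (measurableTypeR R)).
  exact: open_measurable.
rewrite (_ : setT = [set x : R | x != 0] `|` [set 0]); last first.
  apply/seteqP; split => // x _ /=; have [->|] := eqVneq x 0; [by right|by left].
apply/measurable_funU => //; split.
  apply: open_continuous_measurable_fun => // x; rewrite inE /=; exact: inv_continuous.
exact: measurable_fun_set1.
Qed.

Lemma bounded_measV (R : realType) n (D : set 'rV[R]_n) (f : 'rV[R]_n -> R) c :
  0 < c -> measurable_on D f -> (forall x, D x -> c <= f x) -> bounded_meas D (fun x => (f x)^-1).
Proof.
move=> c0 mf fc; split.
  exact: (measurableT_comp (@measurable_inv R)).
exists c^-1 => x /fc h; have f0 : 0 < f x by apply: lt_le_trans h.
rewrite ger0_norm; first by rewrite lef_pV2.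
by rewrite invr_ge0 ltW.
Qed.

(** * Diameters and inscribed balls *)

Section euclid.
Variables (R : realType) (n : nat).
Implicit Types (D A : set 'rV[R]_n) (x y : 'rV[R]_n).

Lemma dotv_ge0 x : 0 <= dotv x x.
Proof. by apply: sumr_ge0 => i _; rewrite -expr2 sqr_ge0. Qed.

Lemma enorm_ge0 x : 0 <= enorm x.
Proof. exact: sqrtr_ge0. Qed.

Lemma coord_le_enorm x i : `|x 0 i| <= enorm x.
Proof.
rewrite -sqrtr_sqr ler_sqrt ?dotv_ge0// /dotv (bigD1 i)//= expr2 lerDl.
by apply: sumr_ge0 => j _; rewrite -expr2 sqr_ge0.
Qed.

Lemma sum_sqr_le (I : finType) (g : I -> R) :
  \sum_i g i * g i <= (\sum_i `|g i|) ^+ 2.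
Proof.
rewrite expr2 mulr_suml; apply: ler_sum => i _.
rewrite -[leLHS]ger0_norm -?expr2 ?sqr_ge0// expr2 normrM ler_wpM2l//.
by rewrite (bigD1 i)//= lerDl sumr_ge0.
Qed.

Lemma enorm_le_sum x : enorm x <= \sum_i `|x 0 i|.
Proof.
rewrite -[leRHS]ger0_norm; last by apply: sumr_ge0.
by rewrite -sqrtr_sqr ler_sqrt ?sqr_ge0//; exact: sum_sqr_le.
Qed.

Lemma bounded_diam_has_sup D a b x : D `<=` box a b -> D x ->
  has_sup [set enorm (x - y) | x in D & y in D].
Proof.
move=> Dab Dx; split; first by exists (enorm (x - x)); exists x => //; exists x.
exists (\sum_i (b 0 i - a 0 i)) => _ [u Du [v Dv <-]].
apply: le_trans (enorm_le_sum _) _; apply: ler_sum => i _; rewrite !mxE.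
have /andP[h1 h2] := Dab _ Du i; have /andP[h3 h4] := Dab _ Dv i.
by rewrite ler_norml; lra.
Qed.

Lemma enorm_le_diam D a b x y : D `<=` box a b -> D x -> D y ->
  enorm (x - y) <= diam D.
Proof.
move=> Dab Dx Dy; apply: sup_ubound; last by exists x => //; exists y.
by have [] := bounded_diam_has_sup Dab Dx.
Qed.

Lemma diam_ge0 D : 0 <= diam D.
Proof.
have [hs|/sup_out] := pselect (has_sup [set enorm (x - y) | x in D & y in D]); last first.
  by rewrite /diam => ->.
case: (hs) => -[_ [x Dx [y Dy _]]] ub.
by apply: le_trans (enorm_ge0 (x - y)) _; apply: sup_ubound => //; exists x => //; exists y.
Qed.

Lemma le_diam A D a b x : A `<=` D -> D `<=` box a b -> A x -> diam A <= diam D.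
Proof.
move=> AD Dab Ax; apply: sup_le_ub.
  by exists (enorm (x - x)); exists x => //; exists x.
move=> _ [u Au [v Av <-]]; apply: enorm_le_diam Dab _ _; exact: AD.
Qed.

Lemma sub_box_diam D a b x : D `<=` box a b -> D x ->
  D `<=` box (x - const_mx (diam D)) (x + const_mx (diam D)).
Proof.
move=> Dab Dx y Dy i; rewrite !mxE.
have := le_trans (coord_le_enorm (y - x) i) (enorm_le_diam Dab Dy Dx).
by rewrite !mxE ler_norml; lra.
Qed.

(** A ball whose diameter exceeds half of the supremum that defines the inball
    diameter contains a cube of half-side a. The 4 comes from that half and from
    the passage to the radius, and n.+1 from the comparison of the Euclidean norm
    with the maximum norm. *)
Lemma inner_box D (sigma : R) : 0 < sigma -> 0 < diam D ->
  diam D <= sigma * inball_diam D ->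
  exists (c : 'rV[R]_n) (a : R), [/\ 0 < a, diam D <= 4 * sigma * n.+1%:R * a &
    box (c - const_mx a) (c + const_mx a) `<=` D].
Proof.
move=> s0 d0 h; have ib0 : 0 < inball_diam D.
  by rewrite -(pmulr_rgt0 _ s0); apply: lt_le_trans h.
have hs : has_sup [set 2 * r | r in [set r : R | 0 < r /\ exists c, eball c r `<=` D]].
  by apply: contrapT => /sup_out; rewrite -/(inball_diam D) => e; rewrite e ltxx in ib0.
have [_ [r [r0 [c cD]] <-]] := sup_adherent (divr_gt0 ib0 (ltr0n R 2)) hs.
rewrite -/(inball_diam D) => hr.
exists c, (r / n.+1%:R); split.
- by rewrite divr_gt0.
- rewrite -[leRHS]mulrA (mulrC n.+1%:R) divfK ?pnatr_eq0//.
  by apply: le_trans h _; rewrite -mulrA mulrCA ler_pM2l//; lra.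
- move=> x hx; apply: cD; rewrite /eball /=.
  apply: le_lt_trans (enorm_le_sum _) _.
  apply: (@le_lt_trans _ _ (\sum_(i < n) r / n.+1%:R)).
    apply: ler_sum => i _; by have /andP[] := hx i; rewrite !mxE ler_norml; move: (r / _) => w; lra.
  rewrite sumr_const card_ord -[_ *+ n]mulr_natr -mulrA gtr_pMr// ltr_pdivrMl// mulr1.
  by rewrite ltr_nat.
Qed.

End euclid.

(** * Simplices *)

Section hulls.
Variables (R : realType) (n : nat) (I : finType) (a : I -> 'rV[R]_n).

Lemma hull_mem (s : {set I}) i : i \in s -> hull a s (a i).
Proof.
move=> si; exists (fun j => (j == i)%:R); split.
- by move=> j _; rewrite ler0n.
- rewrite (bigD1 i)//= eqxx big1 ?addr0// => j /andP[_ /negbTE ->] //.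
- rewrite (bigD1 i)//= eqxx scale1r big1 ?addr0// => j /andP[_ /negbTE ->].
  by rewrite scale0r.
Qed.

Lemma hullS (s s' : {set I}) : s \subset s' -> hull a s `<=` hull a s'.
Proof.
move=> /fintype.subsetP ss' _ [w [w0 w1 ->]].
exists (fun i => if i \in s then w i else 0); split.
- by move=> i _; case: ifP => // /w0.
- rewrite -w1 [RHS]big_mkcond [LHS]big_mkcond /=; apply: eq_bigr => i _.
  by case: ifPn => // /(contra (ss' i)) /negbTE ->.
- rewrite [LHS]big_mkcond [RHS]big_mkcond /=; apply: eq_bigr => i _.
  case: ifPn => [/ss' ->//|_]; by case: ifP => // _; rewrite scale0r.
Qed.

Lemma hull_bounded (s : {set I}) : exists l u, hull a s `<=` box l u.
Proof.
exists (\row_j (- \sum_i `|a i 0 j|)), (\row_j \sum_i `|a i 0 j|).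
move=> _ [w [w0 w1 ->]] j; rewrite !mxE summxE -ler_norml.
apply: le_trans (ler_norm_sum _ _ _) _.
rewrite [leLHS]big_mkcond; apply: ler_sum => i _; case: ifPn => // si.
rewrite !mxE normrM ger0_norm ?w0// ler_piMl// -w1 (bigD1 i)//= lerDl.
by apply: sumr_ge0 => k /andP[sk _]; exact: w0.
Qed.

End hulls.

Section simplices.
Variables (R : realType) (n : nat) (m : mesh R n).
Implicit Types (s e : {set 'I_(nnodes m)}).

(** The barycentric weights of the vertices other than the first one are the
    coordinates of the point in the affine frame at the first vertex. *)
Lemma simplexP k s x : #|s| = k.+1 ->
  simplex s x <-> exists2 t, @reference_simplex R k t & x = vertex s 0 + t *m edges k s.
Proof.
move=> sk; have sz : size (enum s) = k.+1 by rewrite -cardE.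
have x0 : 'I_(nnodes m) by case: (enum s) sz.
have vE j : (j < k.+1)%N -> vertex s j = node (nth x0 (enum s) j).
  by move=> jk; rewrite /vertex (nth_map x0)// sz.
have reindex (V : nmodType) (F : 'I_(nnodes m) -> V) :
    \sum_(i in s) F i = F (nth x0 (enum s) 0) + \sum_(j < k) F (nth x0 (enum s) j.+1).
  rewrite -big_enum (big_nth x0) sz big_mkord big_ord_recl /=.
  by congr (_ + _); apply: eq_bigr => j _.
have tE (t : 'rV[R]_k) : t *m edges k s =
    \sum_(j < k) t 0 j *: (vertex s j.+1 - vertex s 0).
  rewrite mulmx_sum_row; apply: eq_bigr => j _; congr (_ *: _).
  by apply/rowP => l; rewrite !mxE.
split.
  move=> [w [w0 w1 ->]]; exists (\row_j w (nth x0 (enum s) j.+1)).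
    split.
      by move=> j; rewrite mxE w0// -mem_enum mem_nth// sz ltnS.
    under eq_bigr do rewrite mxE.
    rewrite -w1 reindex lerDr w0// -mem_enum mem_nth// sz//.
  rewrite tE reindex (vE 0%N)//.
  under [in RHS]eq_bigr => j _ do rewrite mxE (vE j.+1 (ltn_ord j)) scalerBr.
  rewrite sumrB -scaler_suml [RHS]addrA [RHS]addrAC; congr (_ + _).
  rewrite -[X in X - _]scale1r -scalerBl; congr (_ *: _).
  by apply/eqP; rewrite eq_sym subr_eq -w1 reindex.
move=> [t [t0 t1] ->].
(* W lists the barycentric weights in the order of the vertices. *)
pose W (j : nat) := if j is j'.+1 then (if insub j' is Some o then t 0 o else 0)
                    else 1 - \sum_j t 0 j.
have WS (j : 'I_k) : W j.+1 = t 0 j by rewrite /W valK.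
have uE : uniq (enum s) by exact: enum_uniq.
pose w z := W (index z (enum s)).
have wE j : (j < k.+1)%N -> w (nth x0 (enum s) j) = W j.
  by move=> jk; rewrite /w index_uniq// sz.
exists w; split.
- move=> i _; rewrite /w; case: (index _ _) => [|j] /=; first by rewrite subr_ge0.
  by case: insub.
- rewrite reindex wE//; under eq_bigr => j _ do rewrite (wE j.+1 (ltn_ord j)) WS.
  by rewrite /= subrK.
- rewrite reindex wE// -vE//.
  under [in RHS]eq_bigr => j _ do rewrite (wE j.+1 (ltn_ord j)) WS -(vE j.+1 (ltn_ord j)).
  rewrite tE; under [in LHS]eq_bigr do rewrite scalerBr.
  by rewrite sumrB -scaler_suml /= scalerBl scale1r addrA [in LHS]addrAC.
Qed.

End simplices.

Section reference.
Variables (R : realType) (n k : nat).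
Local Notation pre D := (@row_of_tuple R n @^-1` D).

Lemma measurable_reference (g : 'rV[R]_n -> 'rV[R]_k) :
  (forall i, measurable_fun setT (fun t => g (@row_of_tuple R n t) 0 i)) ->
  measurable (pre (g @^-1` @reference_simplex R k)).
Proof.
move=> mg; rewrite (_ : pre _ =
  (\bigcap_(i in [set: 'I_k]) (((fun x => g x 0 i) \o @row_of_tuple R n) @^-1` [set` `[0, +oo[])) `&`
   ((fun t => \sum_i g (row_of_tuple t) 0 i) @^-1` [set` `]-oo, 1]])).
  apply: measurableI.
    apply: fin_bigcap_measurable; first exact: finite_finset.
    move=> i _; rewrite -[_ @^-1` _]setTI; apply: mg => //; exact: measurable_itv.
  have ms : measurable_fun setT (fun t => \sum_i g (@row_of_tuple R n t) 0 i).
    by apply: measurable_sum => i; exact: mg.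
  by rewrite -[_ @^-1` _]setTI; apply: ms => //; exact: measurable_itv.
apply/seteqP; split => t /=.
  move=> [h1 h2]; split; last by rewrite /= in_itv.
  by move=> i _ /=; rewrite in_itv/= andbT; exact: h1.
move=> [h1 h2]; split; last by move: h2; rewrite /= in_itv.
by move=> i; have := h1 i I; rewrite /= in_itv/= andbT.
Qed.

Lemma closed_reference (g : 'rV[R]_n -> 'rV[R]_k) :
  (forall i, continuous (fun x => g x 0 i)) ->
  closed (g @^-1` @reference_simplex R k).
Proof.
move=> cg; rewrite (_ : g @^-1` _ =
  (\bigcap_(i in [set: 'I_k]) ((fun x => g x 0 i) @^-1` [set x : R | 0 <= x])) `&`
   ((fun x => \sum_i g x 0 i) @^-1` [set x : R | x <= 1])).
  apply: closedI.
    apply: closed_bigI => i _; apply: closed_comp; last exact: closed_ge.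
    by move=> x _; exact: cg.
  apply: closed_comp; last exact: closed_le.
  by move=> x _; apply: continuous_sum; exact: cg.
apply/seteqP; split => t /=.
  by move=> [h1 h2]; split => // i _; exact: h1.
by move=> [h1 h2]; split => // i; exact: h1.
Qed.

Lemma reference_sub_box : @reference_simplex R k `<=` box 0 (const_mx 1).
Proof.
move=> t [t0 t1] i; rewrite !mxE t0/=; apply: le_trans t1.
by rewrite (bigD1 i)//= lerDl sumr_ge0.
Qed.

End reference.

Lemma reference_bounded_meas_set (R : realType) k :
  bounded_meas_set (@reference_simplex R k).
Proof.
split; last by exists 0, (const_mx 1); exact: reference_sub_box.
by apply: (@measurable_reference R k k id) => i; exact: measurable_coord.
Qed.

Section determinants.
Import perm.

Lemma det_norm_le (R : realType) k (A : 'M[R]_k) M : (forall i j, `|A i j| <= M) ->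
  `|\det A| <= k`!%:R * M ^+ k.
Proof.
move=> AM; apply: le_trans (ler_norm_sum _ _ _) _.
apply: (@le_trans _ _ (\sum_(s : 'S_k) M ^+ k)).
  apply: ler_sum => s _; rewrite normrM normrX normrN1 expr1n mul1r normr_prod.
  rewrite -[in leRHS](card_ord k) -prodr_const; apply: ler_prod => i _.
  by rewrite normr_ge0 AM.
by rewrite sumr_const card_Sn mulr_natl.
Qed.

End determinants.

Section cells.
Variables (R : realType) (n : nat) (m : mesh R n).
Implicit Types (s e : {set 'I_(nnodes m)}).

Section cell.
Variable s : {set 'I_(nnodes m)}.
Hypotheses (sn : #|s| = n.+1) (su : edges n s \in unitmx).

Definition affine_coord (x : 'rV[R]_n) : 'rV[R]_n := (x - vertex s 0) *m invmx (edges n s).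

(** In terms of affine coordinates a cell is cut out by finitely many inequalities
    between continuous functions; measurability and closedness follow from that. *)
Lemma simplexE : simplex s = affine_coord @^-1` @reference_simplex R n.
Proof.
apply/seteqP; split => x.
  move=> /(simplexP _ sn)[t ht ->]; rewrite /preimage/= /affine_coord.
  by rewrite addrAC subrr add0r mulmxK.
move=> hx; apply/(simplexP _ sn); exists (affine_coord x) => //.
by rewrite /affine_coord mulmxKV// addrC subrK.
Qed.

Lemma affine_coordE x i : affine_coord x 0 i =
  \sum_j (x 0 j - vertex s 0 0 j) * invmx (edges n s) j i.
Proof. by rewrite mxE; apply: eq_bigr => j _; rewrite !mxE. Qed.

Lemma cell_bounded_meas_set : bounded_meas_set (simplex s).
Proof.
split; last exact: hull_bounded.
rewrite simplexE; apply: measurable_reference => i.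
rewrite (_ : (fun _ => _) = fun t => \sum_j (row_of_tuple t 0 j - vertex s 0 0 j) *
  invmx (edges n s) j i); last by apply/funext => t /=; rewrite affine_coordE.
apply: measurable_sum => j; apply: measurable_funM; last exact: measurable_cst.
by apply: measurable_funB; [exact: measurable_coord|exact: measurable_cst].
Qed.

Lemma cell_closed : closed (simplex s).
Proof.
rewrite simplexE; apply: closed_reference => i.
have -> : (fun x => affine_coord x 0 i) = fun x : 'rV[R]_n => \sum_j (x 0 j + - vertex s 0 0 j) *
  invmx (edges n s) j i by apply/funext => t; rewrite affine_coordE.
apply: continuous_sum => j; apply: continuousM_fun; last exact: cst_continuous.
apply: continuousD_fun; [exact: continuous_coord|exact: cst_continuous].
Qed.

End cell.

Lemma vertex_simplex s i : (i < #|s|)%N -> simplex s (vertex s i).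
Proof.
move=> si; have x0 : 'I_(nnodes m) by move: si; rewrite cardE; case: (enum s).
rewrite /vertex (nth_map x0) -?cardE//; apply: hull_mem.
by rewrite -mem_enum mem_nth// -cardE.
Qed.

Lemma cell_diam_gt0 s : injective (@node R n m) -> (1 < #|s|)%N -> 0 < diam (simplex s).
Proof.
move=> inj /card_gt1P[i [j [si sj ij]]].
have [l [u slu]] := hull_bounded (@node R n m) s.
apply: lt_le_trans (enorm_le_diam slu (hull_mem _ si) (hull_mem _ sj)).
rewrite lt_neqAle enorm_ge0 andbT; apply: contra ij => /eqP e0.
apply/eqP/inj/eqP; rewrite -subr_eq0; apply/eqP/rowP => l'.
rewrite [RHS]mxE; apply/eqP; rewrite -normr_le0 e0; exact: coord_le_enorm.
Qed.

(** The entries of the Gram matrix are at most n times the squared diameter, and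
    its determinant is bounded through the Leibniz formula. *)
Lemma face_area_le e k : #|e| = k.+1 ->
  Num.sqrt (\det (edges k e *m (edges k e)^T)) <= (k`! * n ^ k)%:R * diam (simplex e) ^+ k.
Proof.
move=> ek; have [l [u elu]] := hull_bounded (@node R n m) e.
set h := diam _; have h0 : 0 <= h by exact: diam_ge0.
have c0 : 0 <= (k`! * n ^ k)%:R * h ^+ k by rewrite mulr_ge0 ?exprn_ge0.
rewrite -[leRHS]ger0_norm// -sqrtr_sqr ler_wsqrtr//.
apply: le_trans (ler_norm _) _.
apply: (@le_trans _ _ (k`!%:R * (n%:R * h ^+ 2) ^+ k)).
  apply: det_norm_le => i j; rewrite mxE.
  apply: le_trans (ler_norm_sum _ _ _) _.
  apply: (@le_trans _ _ (\sum_(l < n) h ^+ 2)).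
    apply: ler_sum => l' _; rewrite !mxE normrM expr2.
    have E (q : 'I_k) : `|(vertex e q.+1 - vertex e 0) 0 l'| <= h.
      apply: le_trans (coord_le_enorm _ _) _.
      by apply: enorm_le_diam elu _ _; apply: vertex_simplex; rewrite ek ?ltnS.
    by have := E i; have := E j; rewrite !mxE => hj hi; apply: ler_pM.
  by rewrite sumr_const card_ord mulr_natl.
have -> : (n%:R * h ^+ 2) ^+ k = (n ^ k)%:R * h ^+ (2 * k) by rewrite exprMn natrX exprM.
have -> : ((k`! * n ^ k)%:R * h ^+ k) ^+ 2 = (k`! * n ^ k)%:R ^+ 2 * h ^+ (2 * k).
  by rewrite (mulnC 2 k) [h ^+ (k * 2)]exprM exprMn.
rewrite mulrA -natrM.
rewrite ler_wpM2r ?exprn_ge0// -natrX ler_nat.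
by case: (_ * _)%N => // N; rewrite -mulnn leq_pmulr.
Qed.

End cells.

(** * Inverse estimates on one cell *)

Section cell_estimates.
Variables (R : realType) (n : nat) (D : set 'rV[R]_n) (w : 'rV[R]_n -> R).
Variables (wl wu rho K a h : R) (c x0 : 'rV[R]_n).
Hypotheses (bD : bounded_meas_set D) (bw : bounded_meas D w).
Hypotheses (wl0 : 0 < wl) (ww : forall x, D x -> wl <= w x <= wu) (wr : wu <= rho * wl).
Hypotheses (K0 : 0 < K) (a0 : 0 < a) (h0 : 0 <= h) (hK : h <= K * a).
Hypotheses (cD : box (c - const_mx a) (c + const_mx a) `<=` D).

Let w_ge0 x : D x -> 0 <= w x.
Proof. by move=> /ww/andP[+ _]; apply: le_trans; exact: ltW. Qed.

(** The integral is at least that of a constant over the inscribed box, whose side is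
    comparable with h. *)
Lemma cst_inverse_estimate (q : R) :
  h ^+ n * (wu * q ^+ 2) <= rho * K ^+ n * integral_on D (fun x => w x * q * q).
Proof.
have Dc : D c.
  by apply: cD => i; rewrite !mxE; have := a0; lra.
have rho0 : 0 < rho.
  have /andP[h1 h2] := ww Dc.
  by rewrite -(pmulr_lgt0 _ wl0); apply: lt_le_trans wr; apply: lt_le_trans wl0 (le_trans h1 h2).
have bf : bounded_meas D (fun x => w x * q * q).
  by apply: bounded_measM; [apply: bounded_measM => //|]; exact: bounded_meas_cst.
have := @integral_on_ge_cst _ _ D _ (wl * q ^+ 2) (c - const_mx a) (c + const_mx a) bD bf cD.
have -> : \prod_(i < n) ((c + const_mx a) 0 i - (c - const_mx a) 0 i) = (2 * a) ^+ n.
  rewrite (eq_bigr (fun=> 2 * a)); first by rewrite prodr_const card_ord.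
  by move=> i _; rewrite !mxE; ring.
move=> /(_ _ _ _ _) H; have {}H : wl * q ^+ 2 * (2 * a) ^+ n <=
    integral_on D (fun x => w x * q * q).
  apply: H.
  - by move=> i; rewrite !mxE; have := a0; lra.
  - by move=> x Dx; rewrite -mulrA -expr2 mulr_ge0 ?sqr_ge0 ?w_ge0.
  - move=> x /cD /ww /andP[wx _]; rewrite -mulrA -expr2 ler_wpM2r ?sqr_ge0//.
  - by rewrite mulr_ge0 ?sqr_ge0// ltW.
apply: (@le_trans _ _ (rho * K ^+ n * (wl * q ^+ 2 * (2 * a) ^+ n))); last first.
  by rewrite ler_wpM2l// mulr_ge0 ?exprn_ge0 ?ltW.
have hn : h ^+ n <= K ^+ n * (2 * a) ^+ n.
  rewrite -exprMn lerXn2r ?nnegrE//.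
    by rewrite !mulr_ge0 ?ltW.
  by apply: le_trans hK _; rewrite ler_wpM2l ?ltW//; have := a0; lra.
have -> : rho * K ^+ n * (wl * q ^+ 2 * (2 * a) ^+ n) =
  K ^+ n * (2 * a) ^+ n * (rho * wl * q ^+ 2) by ring.
apply: ler_pM => //; first exact: exprn_ge0.
  have /andP[h1 h2] := ww Dc.
  by rewrite mulr_ge0 ?sqr_ge0// (le_trans _ h2)// (le_trans _ h1)// ltW.
by rewrite ler_wpM2r ?sqr_ge0.
Qed.

(** An affine function with gradient g is at least (a / 2) times the sum of the |g j|
    in absolute value on a box of side a / 2 that lies in a suitable orthant of the
    inscribed box of half-side a. The integral of its square therefore controls
    |g|^2 a^(n + 2), whereas the left-hand side is at most of order
    h^(n + 2) |g|^2, and h <= K a. *)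
Lemma grad_inverse_estimate (p : mpoly n R) : (msize p <= 2)%N ->
  D `<=` box (x0 - const_mx h) (x0 + const_mx h) ->
  h ^+ 2 * integral_on D (fun x => w x * dotv (\row_j meval (x 0) (mderiv j p))
                                      (\row_j meval (x 0) (mderiv j p))) <=
  rho * 2 ^+ n * (2 * K) ^+ n.+2 *
    integral_on D (fun x => w x * meval (x 0) p * meval (x 0) p).
Proof.
move=> p2 Dh.
pose g j := meval (c 0) (mderiv j p).
have aff x y z := meval_affine x y z p2.
(* A unit step in the direction j isolates the j-th derivative. *)
have gE x j : meval x (mderiv j p) = g j.
  have := aff (c 0) (fun i => c 0 i + (i == j)%:R) x.
  have -> := aff (c 0) (fun i => c 0 i + (i == j)%:R) (c 0).
  move/addrI; rewrite (bigD1 j)//= [X in _ + X]big1 ?addr0; last first.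
    by move=> i /negbTE ij; rewrite ij addr0 subrr mul0r.
  rewrite (bigD1 j)//= [X in _ = _ + X]big1 ?addr0; last first.
    by move=> i /negbTE ij; rewrite ij addr0 subrr mul0r.
  by rewrite eqxx addrAC subrr add0r !mul1r => <-.
pose G := \sum_j g j * g j.
have G0 : 0 <= G by apply: sumr_ge0 => j _; rewrite -expr2 sqr_ge0.
have dE x : dotv (\row_j meval (x 0) (mderiv j p)) (\row_j meval (x 0) (mderiv j p)) = G :> R.
  by apply: eq_bigr => j _; rewrite !mxE gE.
rewrite (eq_integral_on (g := fun x => w x * G)); last by move=> x _; rewrite dE.
have Dc : D c by apply: cD => i; rewrite !mxE; have := a0; lra.
have /andP[wc1 wc2] := ww Dc.
have wu0 : 0 < wu by exact: lt_le_trans wl0 (le_trans wc1 wc2).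
have rho0 : 0 < rho by rewrite -(pmulr_lgt0 _ wl0); apply: lt_le_trans wr.
have U : integral_on D (fun x => w x * G) <= wu * G * (2 * h) ^+ n.
  have := @integral_on_le_cst _ _ D (fun x => w x * G) (wu * G) _ _ bD.1 Dh.
  rewrite (eq_bigr (fun=> 2 * h)); last by move=> i _; rewrite !mxE; ring.
  rewrite prodr_const card_ord; apply.
  - by move=> i; rewrite !mxE; have := h0; lra.
  - move=> x Dx; have /andP[_ w2] := ww Dx.
    by rewrite mulr_ge0 ?w_ge0//= ler_wpM2r.
  - by rewrite mulr_ge0// ltW.
(* sg is the sign of the value at the centre. On the orthant of the box selected by the
   signs of the sg * g j, all the terms of the affine function sg * p are nonnegative. *)
pose sg := if 0 <= meval (c 0) p then 1 else -1 : R.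
have sg2 : sg * sg = 1 by rewrite /sg; case: ifP => _; ring.
have sgp : 0 <= sg * meval (c 0) p.
  by rewrite /sg; case: (leP 0 (meval (c 0) p)) => ?; lra.
pose lo : 'rV[R]_n := \row_j (c 0 j + if 0 <= sg * g j then a / 2 else - a).
pose hi : 'rV[R]_n := lo + const_mx (a / 2).
have lohi : box lo hi `<=` box (c - const_mx a) (c + const_mx a).
  move=> x hx j; have /andP[] := hx j; rewrite !mxE; have := a0.
  by case: ifP => _; lra.
have val x : box lo hi x -> (a / 2) ^+ 2 * G <= meval (x 0) p * meval (x 0) p.
  move=> hx; have -> : meval (x 0) p * meval (x 0) p = (sg * meval (x 0) p) ^+ 2.
    by rewrite expr2 mulrACA sg2 mul1r.
  apply: (@le_trans _ _ ((a / 2 * \sum_j `|g j|) ^+ 2)).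
    by rewrite [leRHS]exprMn ler_wpM2l ?sqr_ge0//; exact: sum_sqr_le.
  have H0 : 0 <= a / 2 * \sum_j `|g j| by rewrite mulr_ge0 ?sumr_ge0// divr_ge0// ltW.
  suff H1 : a / 2 * \sum_j `|g j| <= sg * meval (x 0) p.
    by rewrite lerXn2r ?nnegrE// (le_trans H0).
  apply: (@le_trans _ _ (\sum_j sg * ((x 0 j - c 0 j) * g j))).
    rewrite mulr_sumr; apply: ler_sum => j _; have /andP[] := hx j.
    have -> : `|g j| = `|sg * g j|.
      by rewrite normrM /sg; case: ifP => _; rewrite ?normrN normr1 mul1r.
    rewrite !mxE mulrCA; case: (leP 0 (sg * g j)) => s; [rewrite ger0_norm//|rewrite ltr0_norm//] => h1 h2.
      by rewrite ler_wpM2r//; lra.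
    by rewrite mulrN -mulNr ler_wnM2r ?(ltW s)//; lra.
  by rewrite (aff (c 0) (x 0) (c 0)) mulrDr -mulr_sumr lerDr.
have bf : bounded_meas D (fun x => w x * meval (x 0) p * meval (x 0) p).
  by apply: bounded_measM; [apply: bounded_measM => //|]; exact: bounded_meas_meval.
have L : wl * ((a / 2) ^+ 2 * G) * (a / 2) ^+ n <=
    integral_on D (fun x => w x * meval (x 0) p * meval (x 0) p).
  have := @integral_on_ge_cst _ _ D _ (wl * ((a / 2) ^+ 2 * G)) lo hi bD bf
    (subset_trans lohi cD).
  rewrite (eq_bigr (fun=> a / 2)); last by move=> i _; rewrite [hi _ _]mxE addrAC subrr add0r mxE.
  rewrite prodr_const card_ord; apply.
  - by move=> j; rewrite [hi _ _]mxE lerDl mxE divr_ge0// ltW.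
  - by move=> x Dx; rewrite -mulrA -expr2 mulr_ge0 ?sqr_ge0 ?w_ge0.
  - move=> x hx; have /andP[w1 _] := ww (cD (lohi _ hx)).
    by rewrite -mulrA ler_pM ?val ?mulr_ge0 ?sqr_ge0 ?exprn_ge0// ltW.
  - by rewrite !mulr_ge0 ?sqr_ge0// ltW.
have hn : h ^+ n.+2 <= (2 * K) ^+ n.+2 * (a / 2) ^+ n.+2.
  rewrite -exprMn lerXn2r ?nnegrE//.
    by rewrite !mulr_ge0 ?invr_ge0 ?ltW.
  by rewrite (_ : 2 * K * (a / 2) = K * a); [|field].
apply: (@le_trans _ _ (h ^+ 2 * (wu * G * (2 * h) ^+ n))).
  by rewrite ler_wpM2l// sqr_ge0.
apply: (@le_trans _ _ (rho * 2 ^+ n * (2 * K) ^+ n.+2 *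
    (wl * ((a / 2) ^+ 2 * G) * (a / 2) ^+ n))); last first.
  rewrite ler_wpM2l//; apply: mulr_ge0; first by rewrite mulr_ge0 ?exprn_ge0 ?ltW.
  by apply: exprn_ge0; rewrite mulr_ge0 ?ltW.
have -> : h ^+ 2 * (wu * G * (2 * h) ^+ n) = h ^+ n.+2 * (wu * (2 ^+ n * G)).
  by rewrite exprMn !exprS; ring.
have -> : rho * 2 ^+ n * (2 * K) ^+ n.+2 * (wl * ((a / 2) ^+ 2 * G) * (a / 2) ^+ n) =
   ((2 * K) ^+ n.+2 * (a / 2) ^+ n.+2) * (rho * wl * (2 ^+ n * G)).
  by rewrite [(a / 2) ^+ n.+2]exprS [(a / 2) ^+ n.+1]exprS; ring.
apply: ler_pM => //; first exact: exprn_ge0.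
  by rewrite mulr_ge0 ?(ltW wu0)// mulr_ge0 ?exprn_ge0.
by rewrite ler_wpM2r ?mulr_ge0 ?exprn_ge0.
Qed.

End cell_estimates.

(** * The stabilization is bounded by the mass *)

Section mesh_estimates.
Variables (R : realType) (n : nat) (m : mesh R n) (Om : set 'rV[R]_n) (sigma : R).
Hypotheses (n0 : (0 < n)%N) (s0 : 0 < sigma).
Hypotheses (tri : triangulation m Om) (reg : shape_regular m sigma).

Lemma cell_card i : #|cell (m := m) i| = n.+1. Proof. by case: tri => _ h _ _; case: (h i). Qed.

Lemma cell_unit i : edges n (cell (m := m) i) \in unitmx.
Proof. by case: tri => _ h _ _; case: (h i). Qed.

Lemma mesh_cell_bounded i : bounded_meas_set (simplex (cell (m := m) i)).
Proof. by apply: cell_bounded_meas_set; [exact: cell_card|exact: cell_unit]. Qed.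

Lemma cell_sub_closure i : simplex (cell (m := m) i) `<=` closure Om.
Proof. by case: tri => _ _ -> _; move=> x xi; exists i. Qed.

Lemma measurable_closure : measurable (@row_of_tuple R n @^-1` closure Om).
Proof.
case: tri => _ _ -> _; rewrite preimage_bigcup.
apply: fin_bigcup_measurable; first exact: finite_finset.
by move=> i _; case: (mesh_cell_bounded i).
Qed.

Lemma measurable_on_cell d (U : measurableType d) (f : 'rV[R]_n -> U) i :
  measurable_on (closure Om) f -> measurable_on (simplex (cell (m := m) i)) f.
Proof.
apply: measurable_funS; first exact: measurable_closure.
by move=> t; exact: cell_sub_closure.
Qed.

Lemma bounded_meas_on_cell (f : 'rV[R]_n -> R) i : bounded_meas (closure Om) f ->
  bounded_meas (simplex (cell (m := m) i)) f.
Proof.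
by move=> [mf [M fM]]; split; [exact: measurable_on_cell|exists M => x /cell_sub_closure; exact: fM].
Qed.

Lemma cell_inner_box i : exists (c : 'rV[R]_n) (a : R),
  [/\ 0 < a, diam (simplex (cell (m := m) i)) <= 4 * sigma * n.+1%:R * a &
    box (c - const_mx a) (c + const_mx a) `<=` simplex (cell (m := m) i)].
Proof.
apply: inner_box => //; apply: cell_diam_gt0; first by case: tri => -[].
by rewrite cell_card ltnS.
Qed.

Variables (mu : 'rV[R]_n -> R) (mu_min rho gamma2 : R).
Hypotheses (mmu : measurable_on (closure Om) mu) (mu0 : 0 < mu_min) (rho0 : 0 < rho).
Hypotheses (muP : forall x, closure Om x -> mu_min <= mu x <= rho * mu_min).
Hypothesis (g0 : 0 < gamma2).

Let w x := (2 * mu x)^-1.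
(* lower and upper bounds of the weight w; their ratio is rho *)
Let wl := (2 * (rho * mu_min))^-1.
Let wu := (2 * mu_min)^-1.

Let wl0 : 0 < wl. Proof. by rewrite invr_gt0 !mulr_gt0. Qed.
Let wu0 : 0 < wu. Proof. by rewrite invr_gt0 !mulr_gt0. Qed.

Let wr : wu <= rho * wl.
Proof.
rewrite (_ : rho * wl = wu)//; rewrite /wl /wu; field.
by rewrite !lt0r_neq0.
Qed.

Let wP x : closure Om x -> wl <= w x <= wu.
Proof.
move=> /muP/andP[h1 h2]; have mx0 : 0 < mu x by exact: lt_le_trans h1.
by rewrite !lef_pV2 ?posrE ?mulr_gt0 //; rewrite !ler_pM2l ?h1 ?h2.
Qed.

Lemma bounded_meas_weight : bounded_meas (closure Om) w.
Proof.
apply: (@bounded_measV _ _ _ _ (2 * mu_min)); first by rewrite mulr_gt0.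
  by apply: measurable_funM => //; exact: measurable_cst.
by move=> x /muP/andP[h _]; rewrite ler_pM2l.
Qed.

Let K := 4 * sigma * n.+1%:R.
Let K0 : 0 < K. Proof. by rewrite !mulr_gt0. Qed.

Let w_ge0 x : closure Om x -> 0 <= w x.
Proof. by move=> /wP/andP[+ _]; apply: le_trans; exact: ltW. Qed.

Definition cell_mass (q : pwpoly m) i : R :=
  integral_on (simplex (cell (m := m) i)) (fun x => w x * pval q i x * pval q i x).

Lemma cell_mass_ge0 q i : 0 <= cell_mass q i.
Proof.
apply: integral_on_ge0 => x /cell_sub_closure xO.
by rewrite -mulrA -expr2 mulr_ge0 ?sqr_ge0 ?w_ge0.
Qed.

Lemma sh_grad_le (q : pwpoly m) : Pk 1 q ->
  sh GradP1 mu gamma2 q q <=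
  gamma2 * (rho * 2 ^+ n * (2 * K) ^+ n.+2) * L2w w q q.
Proof.
move=> [q2 _]; rewrite /sh -mulrA ler_pM2l// /L2w /mesh_integral mulr_sumr.
apply: ler_sum => i _.
have [c [a [a0 ha cD]]] := cell_inner_box i.
have [l [u lu]] := (mesh_cell_bounded i).2.
have vs : simplex (cell (m := m) i) (vertex (cell (m := m) i) 0).
  by apply: vertex_simplex; rewrite cell_card.
have := @grad_inverse_estimate _ _ _ w wl wu rho K a _ c _ (mesh_cell_bounded i)
  (bounded_meas_on_cell i bounded_meas_weight) wl0 (fun x xi => wP (cell_sub_closure xi)) wr K0 a0
  (diam_ge0 _) ha cD (q i) (q2 i) (sub_box_diam lu vs).
exact.
Qed.

(** By the parallelogram inequality the squared jump is at most twice the sum of the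
    squares on the two sides; extending that sum to all the cells that contain e
    makes it independent of the choice of the sides. *)
Lemma jump_sqr_le (q : pwpoly m) (e : {set 'I_(nnodes m)}) (f : 'I_(ncells m) -> R) x :
  (forall i, 0 <= f i) -> (forall i, e \subset cell (m := m) i -> pval q i x ^+ 2 <= f i) ->
  jump q e x ^+ 2 <= 2 * \sum_(i | e \subset cell (m := m) i) f i.
Proof.
move=> f0 fq; rewrite /jump.
have -> : \sum_(i | e \subset cell (m := m) i) f i =
  \sum_(i <- enum [pred i : 'I_(ncells m) | e \subset cell (m := m) i]) f i by rewrite big_enum.
have : forall i, i \in enum [pred i : 'I_(ncells m) | e \subset cell (m := m) i] ->
   e \subset cell (m := m) i by move=> i; rewrite mem_enum.
case: (enum _) => [|i [|j s]] h; rewrite ?expr0n/= ?mulr_ge0 ?sumr_ge0//.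
rewrite !big_cons addrA mulrDr; apply: (@le_trans _ _ (2 * (f i + f j))); last first.
  by rewrite lerDl mulr_ge0 ?sumr_ge0.
have hi := fq i (h i _); have hj := fq j (h j _).
apply: (@le_trans _ _ (2 * (pval q i x ^+ 2 + pval q j x ^+ 2))); last first.
  by rewrite ler_pM2l// lerD ?hi ?hj// !inE eqxx ?orbT.
rewrite -subr_ge0 (_ : _ - _ = (pval q i x + pval q j x) ^+ 2) ?sqr_ge0//; ring.
Qed.

(** The term of a face e is at most of order h_e^n times the sum of the squares of the
    constant values on the cells that contain e. Each of these is controlled by the
    mass of its cell, and a cell has n + 1 vertices, hence at most 2^(n + 1) faces. *)
Lemma sh_jump_le (q : pwpoly m) : Pk 0 q ->
  sh JumpP0 mu gamma2 q q <=
  gamma2 * (2 * (n.-1`! * n ^ n.-1)%:R * (rho * K ^+ n) * 2 ^+ n.+1) * L2w w q q.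
Proof.
move=> [q1 _]; rewrite /sh -mulrA ler_pM2l//.
set A := (n.-1`! * n ^ n.-1)%:R.
have qc i x : pval q i x = mcoeff (@mnm0 n) (q i).
  by rewrite /pval {1}(msize1_polyC (q1 i)) mevalC.
set z := fun i => mcoeff (@mnm0 n) (q i).
have mass i : diam (simplex (cell (m := m) i)) ^+ n * (wu * z i ^+ 2) <= rho * K ^+ n * cell_mass q i.
  have [c [a [a0 ha cD]]] := cell_inner_box i.
  have := @cst_inverse_estimate _ _ _ w wl wu rho K a _ c (mesh_cell_bounded i)
    (bounded_meas_on_cell i bounded_meas_weight) wl0 (fun x xi => wP (cell_sub_closure xi)) wr K0 a0
    (diam_ge0 _) ha cD (z i).
  rewrite /cell_mass; congr (_ <= _ * _); apply: eq_integral_on => x _.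
  by rewrite qc.
apply: (@le_trans _ _ (\sum_(e | interior_face (m := m) e)
   2 * A * \sum_(i | e \subset cell (m := m) i) rho * K ^+ n * cell_mass q i)).
  apply: ler_sum => e /andP[/eqP en /existsP[i /existsP[j /andP[_ /eqP eij]]]].
  have ei : e \subset cell (m := m) i by rewrite -eij finset.subsetIl.
  have ek : #|e| = n.-1.+1 by rewrite en prednK.
  have eO : simplex e `<=` closure Om by apply: subset_trans (@cell_sub_closure i); exact: hullS.
  have hle i' : e \subset cell (m := m) i' ->
      diam (simplex e) <= diam (simplex (cell (m := m) i')).
    move=> ei'; have [l [u lu]] := (mesh_cell_bounded i').2.
    apply: (le_diam _ lu (vertex_simplex (i := 0) _)); first exact: hullS.
    by rewrite en.
  set h := diam (simplex e).
  have h0 : 0 <= h by exact: diam_ge0.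
  have hz : face_integral e (fun x => (2 * mu x)^-1 * jump q e x * jump q e x) <=
     A * h ^+ n.-1 * (wu * (2 * \sum_(i | e \subset cell (m := m) i) z i ^+ 2)).
    rewrite /face_integral; apply: ler_pM; first exact: sqrtr_ge0.
    - apply: integral_on_ge0 => t ht; rewrite -mulrA -expr2 mulr_ge0 ?sqr_ge0//.
      by apply/w_ge0/eO/(simplexP _ ek); exists t.
    - exact: face_area_le.
    have := @integral_on_le_cst R n.-1 (@reference_simplex R n.-1)
      (fun t => (2 * mu (vertex e 0 + t *m edges n.-1 e))^-1 *
         jump q e (vertex e 0 + t *m edges n.-1 e) *
         jump q e (vertex e 0 + t *m edges n.-1 e))
      (wu * (2 * \sum_(i | e \subset cell (m := m) i) z i ^+ 2)) 0 (const_mx 1)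
      (reference_bounded_meas_set R n.-1).1 (@reference_sub_box R n.-1).
    rewrite [\prod_(_ < _) _]big1 ?mulr1; last by move=> k _; rewrite !mxE subr0.
    apply.
    - by move=> k; rewrite !mxE.
    - move=> t ht; set y := vertex e 0 + _.
      have yO : closure Om y by apply/eO/(simplexP _ ek); exists t.
      have wy := w_ge0 yO; have /andP[_ wyu] := wP yO.
      rewrite -mulrA -expr2 mulr_ge0 ?sqr_ge0//=.
      apply: ler_pM => //; first exact: sqr_ge0.
      apply: jump_sqr_le => i'; first exact: sqr_ge0.
      by rewrite qc.
    - by rewrite mulr_ge0 ?(ltW wu0)// mulr_ge0// sumr_ge0// => k _; exact: sqr_ge0.
  apply: le_trans (ler_wpM2l h0 hz) _.
  have -> : h * (A * h ^+ n.-1 * (wu * (2 * \sum_(i | e \subset cell (m := m) i) z i ^+ 2)))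
    = 2 * A * \sum_(i | e \subset cell (m := m) i) h ^+ n * (wu * z i ^+ 2).
    rewrite -!mulr_sumr -[in h ^+ n](prednK n0) exprS; ring.
  rewrite ler_wpM2l ?mulr_ge0//; apply: ler_sum => i' ei'.
  apply: le_trans (mass i').
  have zz : 0 <= wu * z i' ^+ 2 by exact: mulr_ge0 (ltW wu0) (sqr_ge0 _).
  by rewrite ler_wpM2r// lerXn2r ?nnegrE ?diam_ge0// hle.
rewrite -mulr_sumr -!mulrA !ler_pM2l//; last first.
  by rewrite ltr0n muln_gt0 fact_gt0 expn_gt0 n0.
rewrite (exchange_big_dep xpredT)//=.
rewrite /L2w /mesh_integral !mulr_sumr.
apply: ler_sum => i _; rewrite -/(cell_mass q i) sumr_const.
rewrite -[leLHS]mulr_natl.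
rewrite [leRHS](_ : _ = 2 ^+ n.+1 * (rho * K ^+ n * cell_mass q i)); last by ring.
rewrite ler_wpM2r ?mulr_ge0 ?exprn_ge0 ?cell_mass_ge0 ?(ltW K0) ?(ltW rho0)//.
rewrite -natrX ler_nat -(cell_card i) -card_powerset; apply: subset_leq_card.
by apply/fintype.subsetP => e; rewrite powersetE => /andP[].
Qed.

End mesh_estimates.

(** * Definiteness of the fluid pressure norm *)

Section definiteness.
Variables (R : realType) (n : nat) (m : mesh R n) (Om : set 'rV[R]_n) (sigma : R).
Hypotheses (n0 : (0 < n)%N) (s0 : 0 < sigma).
Hypotheses (tri : triangulation m Om) (reg : shape_regular m sigma).
Variables (kappa : 'rV[R]_n -> 'M[R]_n) (kappa0 : R).
Hypotheses (mk : forall i j, measurable_on (closure Om) (fun x => kappa x i j)).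
Hypothesis (bk : exists M : R, forall (x : 'rV[R]_n) i j, closure Om x -> `|kappa x i j| <= M).
Hypothesis (k0 : 0 < kappa0).
Hypothesis (kP : forall (x : 'rV[R]_n) (xi : 'rV[R]_n), closure Om x ->
       kappa0 * dotv xi xi <= (xi *m kappa x *m xi^T) 0 0).

Lemma kappa_quad_ge0 (x xi : 'rV[R]_n) : closure Om x -> 0 <= (xi *m kappa x *m xi^T) 0 0.
Proof. by move=> /kP h; apply: le_trans (h xi); rewrite mulr_ge0 ?(ltW k0) ?dotv_ge0. Qed.

Lemma kappa_form_ge0 (q : pwpoly m) : 0 <= kappa_form kappa q q.
Proof.
apply: sumr_ge0 => i _; apply: integral_on_ge0 => x xi.
by apply: kappa_quad_ge0; exact: (cell_sub_closure tri xi).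
Qed.

Lemma bounded_meas_kappa (q : pwpoly m) i : bounded_meas (simplex (cell i))
  (fun x => (pgrad q i x *m kappa x *m (pgrad q i x)^T) 0 0).
Proof.
apply: (@bounded_meas_eq _ _ _ (fun x => \sum_l (\sum_j meval (x 0) (mderiv j (q i)) * kappa x j l) *
   meval (x 0) (mderiv l (q i)))).
  move=> x _; rewrite mxE; apply: eq_bigr => l _; rewrite !mxE; congr (_ * _).
  by apply: eq_bigr => j _; rewrite !mxE.
have bD := mesh_cell_bounded tri i.
apply: bounded_meas_sum => l; apply: bounded_measM; last exact: bounded_meas_meval.
apply: bounded_meas_sum => j; apply: bounded_measM; first exact: bounded_meas_meval.
apply: (bounded_meas_on_cell tri); split => //.
by have [M hM] := bk; exists M => x; exact: hM.
Qed.

(** If a partial derivative were nonzero at an interior point of the cell, it would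
    stay away from 0 on a small box around it, and the integral would be positive.
    So the derivatives vanish on a ball, hence identically. *)
Lemma kappa_form_eq0 (q : pwpoly m) : kappa_form kappa q q = 0 ->
  forall i, q i = mpolyC n (mcoeff (@mnm0 n) (q i)).
Proof.
move=> q0 i; apply: mderiv_eq0_const => j.
have Ti : integral_on (simplex (cell i))
    (fun x => (pgrad q i x *m kappa x *m (pgrad q i x)^T) 0 0) = 0.
  apply: (@psumr_eq0P _ _ predT (fun i => integral_on (simplex (cell i))
    (fun x => (pgrad q i x *m kappa x *m (pgrad q i x)^T) 0 0)) _ q0 i) => // i' _.
  apply: integral_on_ge0 => x xi.
  by apply: kappa_quad_ge0; exact: (cell_sub_closure tri xi).
have [c [a [a0 _ cD]]] := cell_inner_box n0 s0 tri reg i.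
apply: mpoly_vanishing_eq0.
apply: (@mpoly_vanishing_ball _ _ _ (c 0) a a0) => y hy.
pose x : 'rV[R]_n := \row_l y l.
have -> : meval y (mderiv j (q i)) = meval (x 0) (mderiv j (q i)).
  by apply: meval_eq => l; rewrite mxE.
set f := fun x : 'rV[R]_n => meval (x 0) (mderiv j (q i)); rewrite -/(f x).
apply/eqP; apply: contraT => fx0.
have e0 : 0 < `|f x| / 2 by rewrite divr_gt0// normr_gt0.
have N1 : nbhs x (f @^-1` ball (f x) (`|f x| / 2)).
  by apply: continuous_meval; exact: nbhsx_ballx.
have N2 : nbhs x (ball c a).
  apply: open_nbhs_nbhs; split; first exact: ball_open.
  by split => // i' l; rewrite [i']ord1 /ball/= mxE distrC; exact: hy.
have [d /= d0 dN] := (nbhs_ballP _ _).1 (filterI N1 N2).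
pose b := const_mx (d / 2) : 'rV[R]_n.
have xb z : box (x - b) (x + b) z -> ball x d z.
  move=> hz; split => // i' l; rewrite [i']ord1 /ball/= distrC; have /andP[] := hz l.
  by have := d0; rewrite !mxE ltr_norml; lra.
have bT : box (x - b) (x + b) `<=` simplex (cell i).
  move=> z /xb/dN[_ [_ hz]]; apply: cD => l.
  by have := hz 0 l; rewrite /ball/= !mxE ltr_norml; lra.
have := @integral_on_ge_cst _ _ _ _ (kappa0 * (f x / 2) ^+ 2) _ _ (mesh_cell_bounded tri i)
  (bounded_meas_kappa q i) bT.
rewrite Ti (eq_bigr (fun=> d)); last by move=> l _; rewrite !mxE; lra.
rewrite prodr_const card_ord => h.
have pos : 0 < kappa0 * (f x / 2) ^+ 2 * d ^+ n.
  by rewrite mulr_gt0 ?exprn_gt0// mulr_gt0// exprn_even_gt0//= mulf_neq0 ?invr_eq0.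
exfalso; move: pos; rewrite ltNge => /negP; apply; apply: h.
- by move=> l; rewrite !mxE; have := d0; lra.
- by move=> z zi; apply: kappa_quad_ge0; exact: (cell_sub_closure tri zi).
- move=> z hz; apply: le_trans (kP _ (cell_sub_closure tri (bT _ hz))).
  rewrite ler_pM2l//; apply: (@le_trans _ _ (f z ^+ 2)).
    have [+ _] := dN _ (xb _ hz); rewrite /preimage/ball/= => hf.
    rewrite -[leLHS]real_normK ?num_real// -[leRHS]real_normK ?num_real//.
    rewrite lerXn2r ?nnegrE//.
    have := ler_normD (f x - f z) (f z); rewrite subrK normrM [`|2^-1|]ger0_norm ?invr_ge0//.
    by move: hf; lra.
  rewrite /dotv (bigD1 j)//= !mxE -expr2 lerDl sumr_ge0// => l _.
  by rewrite -expr2 sqr_ge0.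
- by rewrite mulr_ge0 ?sqr_ge0 ?ltW.
Qed.

(** The union of the cells with one value and the union of the other cells are closed,
    are disjoint by continuity, and cover the connected set closure Om. *)
Lemma locally_constant_eq (q : pwpoly m) (z : 'I_(ncells m) -> R) k : connected Om ->
  (0 < k)%N -> Pk k q -> (forall i x, pval q i x = z i) ->
  forall i j, z i = z j.
Proof.
move=> cO k1 [_ /(_ k1) qc] qz i0 j0.
have [x0 x0j] : exists x, simplex (cell (m := m) j0) x.
  exists (vertex (cell j0) 0); apply: vertex_simplex; by rewrite (cell_card tri).
pose A := \bigcup_(i in [set i | z i = z i0]) simplex (cell (m := m) i).
pose B := \bigcup_(i in [set i | z i != z i0]) simplex (cell (m := m) i).
have clo i : closed (simplex (cell (m := m) i)).
  by apply: cell_closed; [exact: cell_card tri _|exact: cell_unit tri _].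
have cA : closed A by apply: closed_bigcup => // ; exact: finite_finset.
have cB : closed B by apply: closed_bigcup => // ; exact: finite_finset.
have OE : closure Om = \bigcup_(i in [set: 'I_(ncells m)]) simplex (cell i) by case: tri.
have AO : closure Om `&` A = A.
  by apply: setIidr => x [i _ xi]; exact: (cell_sub_closure tri xi).
have AB x : A x -> B x -> False.
  move=> [i /= zi xi] [j /= zj xj]; move: zj.
  by rewrite -(qz j x) -zi -(qz i x) (qc i j x)// eqxx.
have : A = closure Om.
  apply: (connected_closure cO).
  - by exists (vertex (cell i0) 0), i0 => //; apply: vertex_simplex; rewrite (cell_card tri).
  - exists (~` B); first exact: closed_openC.
    apply/seteqP; split => x.
      by move=> Ax; split; [rewrite -AO in Ax; case: Ax|move=> Bx; exact: AB Bx].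
    rewrite OE => -[[i _ xi] nB]; exists i => //=; apply: contrapT => zi.
    by apply: nB; exists i => //=; exact/eqP.
  - by exists A.
move=> AE; have /= : A x0 by rewrite AE; exact: (cell_sub_closure tri x0j).
move=> [i /= <- xi]; rewrite -(qz i x0) -(qz j0 x0); exact: qc.
Qed.

(** A vanishing gradient makes q a constant on the whole domain; if that constant were
    nonzero, the zero trace condition would make Gp a null set. *)
Lemma Qph_definite (Gp Gf : set 'rV[R]_n) k (q : pwpoly m) : connected Om ->
  boundary_partition Om Gp Gf -> ~ surface_null Gp -> (0 < k)%N -> Qph k Gp q ->
  kappa_form kappa q q = 0 -> q = 0.
Proof.
move=> cO [bd _] nG k1 [qk qt] /kappa_form_eq0 qc.
set z := fun i => mcoeff (@mnm0 n) (q i).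
have qz i x : pval q i x = z i by rewrite /pval {1}qc mevalC.
have zz := locally_constant_eq cO k1 qk qz.
apply/ffunP => i; rewrite ffunE qc -/(z i).
suff -> : z i = 0 by rewrite mpolyC0.
apply/eqP; apply: contraT => zi; exfalso; apply: nG => e e0.
have [c [r [r0 cov sm]]] := qt e e0; exists c, r; split => // x Gx; apply: cov; split => //.
have : closure Om x by have : bdry Om x; [rewrite -bd; left|case].
case: (tri) => _ _ -> _ [j _ xj]; exists j; split => //.
by rewrite qz (zz j i).
Qed.

End definiteness.

(** * Inf-sup conditions and changes of sign *)

Section infsup_intro.
Variables (R : realType) (X : zmodType) (S : set X) (b : X -> X -> R) (N : X -> R).

(** The quotient is 0 as soon as one of the norms vanishes, so a lower bound on the
    form only helps together with the positivity of both norms. *)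
Lemma infsup_ge (beta : R) :
  (forall x, S x -> x != 0 -> exists y, [/\ S y, y != 0, 0 < N x, 0 < N y &
     beta * (N x * N y) <= b x y]) ->
  (beta%:E <= infsup S b N)%E.
Proof.
move=> h; apply: le_ereal_inf_tmp => _ [x [Sx x0] <-].
have [y [Sy y0 Nx Ny hb]] := h x Sx x0.
apply: (@le_trans _ _ (b x y / (N x * N y))%:E).
  by rewrite lee_fin ler_pdivlMr// mulr_gt0.
by apply: ereal_sup_ubound; exists y.
Qed.

(** The supremum may not be attained: half of the constant remains. Since the quotient
    is 0 when a norm vanishes, the condition makes the norm of every nonzero x
    positive. *)
Lemma infsup_witness (C : R) : 0 < C -> (forall x, 0 <= N x) ->
  (C%:E <= infsup S b N)%E -> forall x, S x -> x != 0 ->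
  exists y, [/\ S y, y != 0, 0 < N x, 0 < N y & C / 2 * (N x * N y) <= b x y].
Proof.
move=> C0 N0 h x Sx x0.
have : ((C / 2)%:E < ereal_sup [set (b x y / (N x * N y))%:E | y in [set y | S y /\ y != 0%R]])%E.
  apply: (@lt_le_trans _ _ C%:E); first by rewrite lte_fin; lra.
  by apply: le_trans h _; apply: ereal_inf_lbound; exists x.
move=> /ereal_sup_gt[_ [y [Sy y0] <-]]; rewrite lte_fin => hy.
have NN : 0 < N x * N y.
  rewrite lt_neqAle mulr_ge0// andbT eq_sym; apply: contraTneq hy => ->.
  by rewrite invr0 mulr0 -leNgt; lra.
exists y; split => //; try by rewrite lt_neqAle N0 andbT eq_sym;
  apply: contraTneq NN => ->; rewrite ?mul0r ?mulr0 ltxx.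
by rewrite -ler_pdivlMr// ltW.
Qed.

End infsup_intro.

Section negation.
Variables (R : realType) (n : nat) (m : mesh R n).
Implicit Types (p q : pwpoly m) (u v : pwpolyv m).

Lemma pvalN q i x : pval (- q) i x = - pval q i x.
Proof. by rewrite /pval ffunE mevalN. Qed.

Lemma pgradN q i x : pgrad (- q) i x = - pgrad q i x.
Proof. by apply/rowP => j; rewrite !mxE ffunE mderivN mevalN. Qed.

Lemma mesh_integralN (F : 'I_(ncells m) -> 'rV[R]_n -> R) :
  mesh_integral (fun i x => - F i x) = - mesh_integral F.
Proof. by rewrite /mesh_integral -sumrN; apply: eq_bigr => i _; rewrite integral_onN. Qed.

Lemma eq_mesh_integral (F G : 'I_(ncells m) -> 'rV[R]_n -> R) :
  (forall i x, simplex (cell i) x -> F i x = G i x) -> mesh_integral F = mesh_integral G.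
Proof. by move=> FG; apply: eq_bigr => i _; apply: eq_integral_on => x; exact: FG. Qed.

Lemma L2wNr w p q : L2w w p (- q) = - L2w w p q.
Proof.
by rewrite -mesh_integralN; apply: eq_mesh_integral => i x _; rewrite pvalN mulrN.
Qed.

Lemma L2wNl w p q : L2w w (- p) q = - L2w w p q.
Proof.
by rewrite -mesh_integralN; apply: eq_mesh_integral => i x _; rewrite pvalN mulrN mulNr.
Qed.

Lemma div_formN u q : div_form u (- q) = - div_form u q.
Proof.
by rewrite -mesh_integralN; apply: eq_mesh_integral => i x _; rewrite pvalN mulNr.
Qed.

Lemma kappa_formNr kappa p q : kappa_form kappa p (- q) = - kappa_form kappa p q.
Proof.
rewrite -mesh_integralN; apply: eq_mesh_integral => i x _.
by rewrite pgradN !mulNmx mxE.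
Qed.

Lemma kappa_formNl kappa p q : kappa_form kappa (- p) q = - kappa_form kappa p q.
Proof.
rewrite -mesh_integralN; apply: eq_mesh_integral => i x _.
by rewrite pgradN [(- _)^T]raddfN /= mulmxN mxE.
Qed.

Lemma jumpN q e x : jump (- q) e x = - jump q e x.
Proof.
rewrite /jump; case: (enum _) => [|i [|j s]]; rewrite ?oppr0//.
by rewrite !pvalN opprB opprK addrC.
Qed.

Lemma shNr st mu g p q : sh st mu g p (- q) = - sh st mu g p q.
Proof.
case: st; rewrite /sh -mulrN; congr (_ * _); rewrite -sumrN; apply: eq_bigr => i _;
  rewrite -mulrN; congr (_ * _).
  rewrite /face_integral -mulrN -integral_onN; congr (_ * _).
  by apply: eq_integral_on => t _; rewrite jumpN mulrN.
rewrite -integral_onN; apply: eq_integral_on => x _.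
by rewrite pgradN -mulrN /dotv -sumrN; congr (_ * _); apply: eq_bigr => j _; rewrite !mxE mulrN.
Qed.

Lemma shNl st mu g p q : sh st mu g (- p) q = - sh st mu g p q.
Proof.
case: st; rewrite /sh -mulrN; congr (_ * _); rewrite -sumrN; apply: eq_bigr => i _;
  rewrite -mulrN; congr (_ * _).
  rewrite /face_integral -mulrN -integral_onN; congr (_ * _).
  by apply: eq_integral_on => t _; rewrite jumpN mulrN mulNr.
rewrite -integral_onN; apply: eq_integral_on => x _.
by rewrite pgradN -mulrN /dotv -sumrN; congr (_ * _); apply: eq_bigr => j _; rewrite !mxE mulNr.
Qed.

Lemma L2w0 w p : L2w w p 0 = 0.
Proof. by have := L2wNr w p 0; rewrite oppr0; lra. Qed.

Lemma kappa_form0 kappa p : kappa_form kappa p 0 = 0.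
Proof. by have := kappa_formNr kappa p 0; rewrite oppr0; lra. Qed.

Lemma PkN k q : Pk k q -> Pk k (- q).
Proof.
move=> [q1 q2]; split; first by move=> i; rewrite ffunE msizeN.
by move=> k0 i j x xi xj; rewrite !pvalN (q2 k0 i j).
Qed.

Lemma QthN st q : Qth st q -> Qth st (- q).
Proof. by case: st => /=; exact: PkN. Qed.

Lemma QphN k G q : Qph k G q -> Qph k G (- q).
Proof.
move=> [qk qt]; split; first exact: PkN.
move=> e /qt[c [r [r0 cov sm]]]; exists c, r; split => // x [Gx [i [xi nz]]].
by apply: cov; split => //; exists i; split => //; rewrite pvalN oppr_eq0 in nz.
Qed.

Lemma Qph0 k G q : Qph k G q -> Qph k G (0 : pwpoly m).
Proof.
move=> [_ qt]; split.
  split; first by move=> i; rewrite ffunE msize0.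
  by move=> _ i j x _ _; rewrite /pval !ffunE.
move=> e /qt[c [r [r0 _ sm]]]; exists c, r; split => // x [_ [i [_]]].
by rewrite /pval ffunE meval0 eqxx.
Qed.

End negation.

(** * Bilinear forms on a mesh *)

Section stabilization_bound.
Variables (R : realType) (n : nat) (Om : set 'rV[R]_n) (sigma rho gamma2 : R).

(** The constant depends neither on the mesh, once its shape regularity is fixed, nor
    on the scale of mu, once its relative oscillation rho is fixed. *)
Lemma sh_le (st : stabilization) : (0 < n)%N -> 0 < sigma -> 0 < rho -> 0 < gamma2 ->
  exists K, 0 <= K /\ forall (m : mesh R n) (mu : 'rV[R]_n -> R) (mu_min : R),
    triangulation m Om -> shape_regular m sigma -> measurable_on (closure Om) mu ->
    0 < mu_min -> (forall x, closure Om x -> mu_min <= mu x <= rho * mu_min) ->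
    forall q : pwpoly m, Qth st q ->
      sh st mu gamma2 q q <= K * L2w (fun x => (2 * mu x)^-1) q q.
Proof.
move=> n0 s0 r0 g0; case: st.
  exists (gamma2 * (2 * (n.-1`! * n ^ n.-1)%:R * (rho * (4 * sigma * n.+1%:R) ^+ n) * 2 ^+ n.+1)).
  split; first by do !first [exact: ltW | exact: ler0n | apply: exprn_ge0 | apply: mulr_ge0].
  by move=> m mu mu_min tri reg mmu mu0 muP q hq; exact: (sh_jump_le n0 s0 tri reg mmu mu0).
exists (gamma2 * (rho * 2 ^+ n * (2 * (4 * sigma * n.+1%:R)) ^+ n.+2)).
split; first by do !first [exact: ltW | exact: ler0n | apply: exprn_ge0 | apply: mulr_ge0].
by move=> m mu mu_min tri reg mmu mu0 muP q hq; exact: (sh_grad_le n0 s0 tri reg mmu mu0).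
Qed.

End stabilization_bound.

Section nonnegativity.
Variables (R : realType) (n : nat) (m : mesh R n) (Om : set 'rV[R]_n).
Hypothesis tri : triangulation m Om.

Lemma mesh_integral_ge0 (F : 'I_(ncells m) -> 'rV[R]_n -> R) :
  (forall i x, closure Om x -> 0 <= F i x) -> 0 <= mesh_integral F.
Proof.
move=> F0; apply: sumr_ge0 => i _; apply: integral_on_ge0 => x xi.
by apply: F0; exact: (cell_sub_closure tri xi).
Qed.

Lemma L2w_ge0 w (q : pwpoly m) : (forall x, closure Om x -> 0 <= w x) -> 0 <= L2w w q q.
Proof.
by move=> w0; apply: mesh_integral_ge0 => i x xO; rewrite -mulrA -expr2 mulr_ge0 ?w0 ?sqr_ge0.
Qed.

Variable mu : 'rV[R]_n -> R.
Hypothesis mu0 : forall x, closure Om x -> 0 < mu x.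

Lemma elasticity_ge0 (u : pwpolyv m) : 0 <= elasticity mu u u.
Proof.
apply: mesh_integral_ge0 => i x /mu0 h; rewrite mulr_ge0//.
  by rewrite mulr_ge0// ltW.
by apply: sumr_ge0 => l _; apply: sumr_ge0 => j _; rewrite -expr2 sqr_ge0.
Qed.

Lemma sh_ge0 st g (q : pwpoly m) : (0 < n)%N -> 0 < g -> 0 <= sh st mu g q q.
Proof.
move=> n0 g0; have w0 x : closure Om x -> 0 <= (2 * mu x)^-1.
  by move=> /mu0 h; rewrite invr_ge0 mulr_ge0// ltW.
case: st; rewrite /sh mulr_ge0 ?(ltW g0)//; apply: sumr_ge0.
  move=> e /andP[/eqP en /existsP[i /existsP[j /andP[_ /eqP eij]]]].
  have ek : #|e| = n.-1.+1 by rewrite en prednK.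
  rewrite mulr_ge0 ?diam_ge0// mulr_ge0 ?sqrtr_ge0//.
  apply: integral_on_ge0 => t ht; rewrite -mulrA -expr2 mulr_ge0 ?sqr_ge0//; apply: w0.
  apply: (cell_sub_closure tri (i := i)); apply: (@hullS _ _ _ _ e).
    by rewrite -eij finset.subsetIl.
  by apply/(simplexP _ ek); exists t.
move=> i _; rewrite mulr_ge0 ?sqr_ge0//; apply: integral_on_ge0 => x xi.
by rewrite mulr_ge0 ?dotv_ge0 ?w0//; exact: (cell_sub_closure tri xi).
Qed.

End nonnegativity.

Section linearity.
Variables (R : realType) (n : nat) (m : mesh R n) (Om : set 'rV[R]_n).
Hypothesis tri : triangulation m Om.
Implicit Types (F G : 'I_(ncells m) -> 'rV[R]_n -> R).

Definition mesh_bounded_meas F := forall i, bounded_meas (simplex (cell i)) (F i).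

Lemma mesh_bounded_measD F G : mesh_bounded_meas F -> mesh_bounded_meas G -> mesh_bounded_meas (fun i x => F i x + G i x).
Proof. by move=> bF bG i; exact: bounded_measD. Qed.

Lemma mesh_bounded_measZ c F : mesh_bounded_meas F -> mesh_bounded_meas (fun i x => c * F i x).
Proof. by move=> bF i; apply: bounded_measM => //; exact: bounded_meas_cst. Qed.

Lemma mesh_integralD F G : mesh_bounded_meas F -> mesh_bounded_meas G ->
  mesh_integral (fun i x => F i x + G i x) = mesh_integral F + mesh_integral G.
Proof.
move=> hF hG; rewrite /mesh_integral -big_split; apply: eq_bigr => i _.
by apply: integral_onD => //; exact: (mesh_cell_bounded tri).
Qed.

Lemma mesh_integralZ c F : mesh_bounded_meas F ->
  mesh_integral (fun i x => c * F i x) = c * mesh_integral F.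
Proof.
move=> hF; rewrite /mesh_integral mulr_sumr; apply: eq_bigr => i _.
by apply: integral_onZ => //; exact: (mesh_cell_bounded tri).
Qed.

Lemma le_mesh_integral F G : mesh_bounded_meas F -> mesh_bounded_meas G ->
  (forall i x, closure Om x -> F i x <= G i x) -> mesh_integral F <= mesh_integral G.
Proof.
move=> hF hG FG; apply: ler_sum => i _.
apply: le_integral_on => //; first exact: (mesh_cell_bounded tri).
by move=> x xi; apply: FG; exact: (cell_sub_closure tri xi).
Qed.

Lemma mesh_bounded_meas_L2 w (p q : pwpoly m) : bounded_meas (closure Om) w ->
  mesh_bounded_meas (fun i x => w x * pval p i x * pval q i x).
Proof.
move=> bw i; have bD := mesh_cell_bounded tri i.
apply: bounded_measM; [apply: bounded_measM; first exact: (bounded_meas_on_cell tri)|]; exact: bounded_meas_meval.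
Qed.

End linearity.

(** * The coupling of the two pressures *)

Section coupling.
Variables (R : realType) (n : nat) (m : mesh R n) (Om : set 'rV[R]_n).
Hypothesis tri : triangulation m Om.
Variables (w s0 : 'rV[R]_n -> R) (alpha : R).
Hypotheses (bw : bounded_meas (closure Om) w) (bs : bounded_meas (closure Om) s0).
Hypothesis w0 : forall x, closure Om x -> 0 <= w x.
Variables (pt pp : pwpoly m).

(** The square of the norm of pt + alpha pp with weight w; for w the inverse of
    lambda, this is the part of the energy that couples the two pressures. *)
Definition coupling_energy : R :=
  mesh_integral (fun i x => w x * (pval pt i x + alpha * pval pp i x) ^+ 2).

Let bounded_meas_energy : mesh_bounded_meas (m := m)
  (fun i x => w x * (pval pt i x + alpha * pval pp i x) ^+ 2).
Proof.
move=> i; have bD := mesh_cell_bounded tri i.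
apply: bounded_measM; first exact: (bounded_meas_on_cell tri).
apply: bounded_measX; apply: bounded_measD; first exact: bounded_meas_meval.
by apply: bounded_measM; [exact: bounded_meas_cst|exact: bounded_meas_meval].
Qed.

Let bounded_meas_aw : bounded_meas (closure Om) (fun x => alpha * w x).
Proof. by apply: bounded_measM => //; exact: bounded_meas_cst. Qed.

Lemma coupling_energy_ge0 : 0 <= coupling_energy.
Proof. by apply: (mesh_integral_ge0 tri) => i x xO; rewrite mulr_ge0 ?w0 ?sqr_ge0. Qed.

(** Completing the square in the four terms that contain the inverse of lambda. *)
Lemma coupling_energyE :
  L2w w pt pt + L2w (fun z => alpha * w z) pp pt + L2w (fun z => alpha * w z) pt pp
  + L2w (fun z => s0 z + alpha ^+ 2 * w z) pp pp = L2w s0 pp pp + coupling_energy.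
Proof.
have b1 := mesh_bounded_meas_L2 tri pt pt bw.
have b2 := mesh_bounded_meas_L2 tri pp pt bounded_meas_aw.
have b3 := mesh_bounded_meas_L2 tri pt pp bounded_meas_aw.
have b4 : mesh_bounded_meas (m := m) (fun i x => (s0 x + alpha ^+ 2 * w x) * pval pp i x * pval pp i x).
  apply: (mesh_bounded_meas_L2 tri); apply: bounded_measD => //; apply: bounded_measM => //; exact: bounded_meas_cst.
have b5 := mesh_bounded_meas_L2 tri pp pp bs.
rewrite /L2w /coupling_energy -!(mesh_integralD tri)//.
- by apply: eq_mesh_integral => i x _; ring.
- exact: (mesh_bounded_measD (mesh_bounded_measD b1 b2) b3).
- exact: (mesh_bounded_measD b1 b2).
Qed.

(** Young's inequality under the integral, for the product of pt + alpha pp with q. *)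
Lemma coupling_young (theta : R) (q : pwpoly m) : 0 < theta ->
  L2w w pt q + L2w (fun z => alpha * w z) pp q <=
  theta / 2 * L2w w q q + (2 * theta)^-1 * coupling_energy.
Proof.
move=> t0.
have b1 := mesh_bounded_meas_L2 tri pt q bw.
have b2 := mesh_bounded_meas_L2 tri pp q bounded_meas_aw.
have b3 := mesh_bounded_meas_L2 tri q q bw.
rewrite /L2w /coupling_energy -!(mesh_integralZ tri)// -!(mesh_integralD tri)//; try exact: mesh_bounded_measZ.
apply: (le_mesh_integral tri); [exact: mesh_bounded_measD|by apply: mesh_bounded_measD; exact: mesh_bounded_measZ|].
move=> i x xO; rewrite -subr_ge0.
rewrite (_ : _ - _ = w x / (2 * theta) * (theta * pval q i x - (pval pt i x + alpha * pval pp i x)) ^+ 2).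
  by rewrite mulr_ge0 ?sqr_ge0// divr_ge0 ?w0// mulr_ge0// ltW.
by field; rewrite lt0r_neq0.
Qed.

Lemma L2w_le (w' : 'rV[R]_n -> R) c (q : pwpoly m) : bounded_meas (closure Om) w' ->
  (forall x, closure Om x -> w x <= c * w' x) -> L2w w q q <= c * L2w w' q q.
Proof.
move=> bw' ww'; have b' := mesh_bounded_meas_L2 tri q q bw'.
rewrite /L2w -(mesh_integralZ tri)//; apply: (le_mesh_integral tri).
- exact: (mesh_bounded_meas_L2 tri).
- by move=> i; apply: bounded_measM => //; exact: bounded_meas_cst.
- by move=> i x xO; rewrite -!mulrA -!expr2 mulrA ler_wpM2r ?sqr_ge0 ?ww'.
Qed.

End coupling.

Section lambda.
Variables (R : realType) (n : nat) (Om : set 'rV[R]_n) (lambda : 'rV[R]_n -> \bar R).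
Variables (low c : R) (mu : 'rV[R]_n -> R).
Hypotheses (low0 : 0 < low) (c0 : 0 < c).
Hypothesis lowP : forall x, closure Om x -> (low%:E <= lambda x)%E.

(** Where lambda is infinite, its finite part is 0, whose inverse is 0 as well. *)
Lemma lambda_invE x : closure Om x -> lambda_inv lambda x = (fine (lambda x))^-1.
Proof.
move=> /lowP; rewrite /lambda_inv; case: (lambda x) => [r| |]//=.
  rewrite lee_fin => h; have r0 : 0 < r by exact: lt_le_trans h.
  by rewrite inver (gt_eqF r0).
by rewrite invr0.
Qed.

Lemma lambda_inv_bounds x : closure Om x -> 0 <= lambda_inv lambda x <= low^-1.
Proof.
move=> xO; rewrite lambda_invE//; move: (lowP xO); case: (lambda x) => [r| |]//=.
  rewrite lee_fin => h; have r0 : 0 < r by exact: lt_le_trans h.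
  by rewrite invr_ge0 (ltW r0) lef_pV2.
by move=> _; rewrite invr0 lexx /= invr_ge0 ltW.
Qed.

Lemma bounded_meas_lambda_inv : measurable_on (closure Om) lambda ->
  bounded_meas (closure Om) (lambda_inv lambda).
Proof.
move=> ml; split; last first.
  by exists low^-1 => x /lambda_inv_bounds/andP[h1 h2]; rewrite ger0_norm.
apply: (@eq_measurable_fun _ _ _ _ _ (fun t => (fine (lambda (row_of_tuple t)))^-1)).
  by move=> t; rewrite inE => tO /=; rewrite lambda_invE.
apply: (measurableT_comp (@measurable_inv R)).
exact: (measurableT_comp (@fine_measurable R setT measurableT)).
Qed.

(** Since mu is at most a multiple of lambda, the weight of the coupling terms is
    dominated by the weight of the solid pressure norm, however large lambda is. *)
Lemma lambda_inv_le x : closure Om x -> 0 < mu x -> ((mu x)%:E <= c%:E * lambda x)%E ->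
  lambda_inv lambda x <= 2 * c * (2 * mu x)^-1.
Proof.
move=> xO m0; rewrite lambda_invE//; move: (lowP xO); case: (lambda x) => [r| |]//=.
  rewrite lee_fin -EFinM lee_fin => h hm; have r0 : 0 < r by exact: lt_le_trans h.
  rewrite invfM mulrACA divff// mul1r -div1r ler_pdivrMr// mulrAC ler_pdivlMr//.
  by rewrite mul1r.
by rewrite invr0 !mulr_ge0 ?invr_ge0 ?mulr_ge0 ?(ltW c0) ?(ltW m0).
Qed.

End lambda.

(** * The inf-sup condition *)

Lemma le_of_sqr (R : rcfType) (a b : R) : 0 <= b -> a ^+ 2 <= b ^+ 2 -> a <= b.
Proof.
move=> b0; rewrite -ler_sqrt ?sqr_ge0// !sqrtr_sqr (ger0_norm b0).
by apply: le_trans; exact: ler_norm.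
Qed.

Lemma sqr_sum_ge (R : realDomainType) (a b A B : R) :
  0 <= a -> 0 <= b -> a ^+ 2 = A -> b ^+ 2 = B -> A + B <= (a + b) ^+ 2.
Proof. by move=> a0 b0 <- <-; have := mulr_ge0 a0 b0; rewrite sqrrD; lra. Qed.

(** Here a, b and c stand for the elastic energy, the mass and the stabilization of
    a test function, and W for its norm in the Stokes condition. *)
Lemma stabilized_norm_le (R : realDomainType) (K a b c W : R) :
  0 <= K -> 0 <= a -> 0 <= b -> c <= K * b -> a + b <= W ^+ 2 -> a + (b + c) <= ((1 + K) * W) ^+ 2.
Proof.
move=> K0 a0 b0 cb abW.
apply: (@le_trans _ _ ((1 + K) * (a + b))).
  by rewrite mulrDl mul1r mulrDr; have := mulr_ge0 K0 a0; lra.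
apply: (@le_trans _ _ ((1 + K) * W ^+ 2)).
  by rewrite ler_wpM2l// addr_ge0.
by rewrite exprMn ler_wpM2r ?sqr_ge0// expr2 ler_peMl ?lerDl// addr_ge0.
Qed.

Section main.
Variables (R : realType) (n : nat) (m : mesh R n) (Om Gp Gd : set 'rV[R]_n).
Variables (st : stabilization) (k : nat).
Variables (mu : 'rV[R]_n -> R) (lambda : 'rV[R]_n -> \bar R) (s0 : 'rV[R]_n -> R).
Variables (kappa : 'rV[R]_n -> 'M[R]_n) (alpha gamma2 C K cl : R).

Local Notation li := (lambda_inv lambda).
Local Notation wmu := (fun x => (2 * mu x)^-1).
Local Notation S1 := [set x : pwpolyv m * pwpoly m | Vh Gd x.1 /\ Qth st x.2].
Local Notation S2 := [set x : biot_space m | [/\ Vh Gd x.1.1, Qth st x.1.2 & Qph k Gp x.2]].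
Local Notation N2 := (norm_biot st mu gamma2 s0 kappa).

Hypotheses (n0 : (0 < n)%N) (tri : triangulation m Om).
Hypotheses (mu0 : forall x, closure Om x -> 0 < mu x) (g0 : 0 < gamma2).
Hypotheses (bmu : bounded_meas (closure Om) wmu) (bli : bounded_meas (closure Om) li).
Hypotheses (li0 : forall x, closure Om x -> 0 <= li x).
Hypotheses (cl0 : 0 < cl) (liP : forall x, closure Om x -> li x <= 2 * cl * (2 * mu x)^-1).
Hypotheses (bs : bounded_meas (closure Om) s0) (s00 : forall x, closure Om x -> 0 <= s0 x).
Hypothesis (kappa_ge0 : forall q : pwpoly m, 0 <= kappa_form kappa q q).
Hypothesis (kappa_def : forall q : pwpoly m, Qph k Gp q -> kappa_form kappa q q = 0 -> q = 0).
Hypotheses (K0 : 0 <= K)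
  (shK : forall q : pwpoly m, Qth st q -> sh st mu gamma2 q q <= K * L2w wmu q q).
Hypotheses (C0 : 0 < C)
  (stokesP : (C%:E <= infsup S1 (stokes st mu gamma2) (norm_stokes mu))%E).

Let wmu0 x : closure Om x -> 0 <= wmu x.
Proof. by move=> /mu0 h; rewrite invr_ge0 mulr_ge0// ltW. Qed.

Lemma norm_biot_sqr (x : biot_space m) : N2 x ^+ 2 =
  elasticity mu x.1.1 x.1.1 + (L2w wmu x.1.2 x.1.2 + sh st mu gamma2 x.1.2 x.1.2)
  + (L2w s0 x.2 x.2 + kappa_form kappa x.2 x.2).
Proof.
have h1 := elasticity_ge0 tri mu0 x.1.1.
have h2 := L2w_ge0 tri x.1.2 wmu0.
have h3 := sh_ge0 tri mu0 st x.1.2 n0 g0.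
have h4 := L2w_ge0 tri x.2 s00; have h5 := kappa_ge0 x.2.
rewrite /norm_biot /normV /normQth /normQph !sqr_sqrtr ?addr_ge0//.
Qed.

Lemma norm_biot_ge0 (x : biot_space m) : 0 <= N2 x. Proof. exact: sqrtr_ge0. Qed.

Lemma norm_stokes_ge0 (x : pwpolyv m * pwpoly m) : 0 <= norm_stokes mu x.
Proof. by rewrite addr_ge0 ?sqrtr_ge0. Qed.

Lemma norm_biot_ge_stokes (x : biot_space m) :
  norm_stokes mu x.1 ^+ 2 <= 2 * N2 x ^+ 2.
Proof.
have h1 := elasticity_ge0 tri mu0 x.1.1.
have h2 := L2w_ge0 tri x.1.2 wmu0.
have h3 := sh_ge0 tri mu0 st x.1.2 n0 g0.
have h4 := L2w_ge0 tri x.2 s00; have h5 := kappa_ge0 x.2.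
rewrite norm_biot_sqr /norm_stokes; have := sqr_sqrtr h1; have := sqr_sqrtr h2.
rewrite -/(normV mu x.1.1) -/(normQt mu x.1.2); move: (normV _ _) (normQt _ _) => V Q.
by have := sqr_ge0 (V - Q); nra.
Qed.

(** Definiteness in the displacement and the solid pressure comes from the Stokes
    inf-sup condition, and in the fluid pressure from its own norm. *)
Lemma norm_biot_gt0 (x : biot_space m) : S2 x -> x != 0 -> 0 < N2 x.
Proof.
move=> [xV xQ xP] x0; rewrite lt_neqAle norm_biot_ge0 andbT eq_sym.
have [x10|x10] := eqVneq x.1 0.
  have x20 : x.2 != 0 by apply: contra x0 => /eqP x20; rewrite [x]surjective_pairing x10 x20.
  apply: contra x20 => /eqP Nx; apply/eqP/kappa_def => //.
  have h1 := elasticity_ge0 tri mu0 x.1.1.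
  have h2 := L2w_ge0 tri x.1.2 wmu0.
  have h3 := sh_ge0 tri mu0 st x.1.2 n0 g0.
  have h4 := L2w_ge0 tri x.2 s00; have h5 := kappa_ge0 x.2.
  by have := norm_biot_sqr x; rewrite Nx expr0n /=; lra.
have [y [_ _ Nx _ _]] := infsup_witness C0 norm_stokes_ge0 stokesP (conj xV xQ) x10.
apply/eqP => Nx0; have := norm_biot_ge_stokes x; rewrite Nx0 expr0n mulr0 leNgt.
by rewrite exprn_gt0.
Qed.

Lemma norm_biotN (u : pwpolyv m) (pt pp : pwpoly m) :
  N2 (u, - pt, - pp) = N2 (u, pt, pp).
Proof.
by rewrite /norm_biot /normQth /normQph !L2wNr !L2wNl shNr shNl kappa_formNr kappa_formNl !opprK.
Qed.

(** Reversing the signs of both pressures makes all the terms of the form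
    nonnegative. This controls everything except the mass of pt. *)
Lemma biot_energy (u : pwpolyv m) (pt pp : pwpoly m) : biot st mu gamma2 lambda alpha s0 kappa (u, pt, pp) (u, - pt, - pp) =
  elasticity mu u u + sh st mu gamma2 pt pt + (L2w s0 pp pp + kappa_form kappa pp pp)
  + coupling_energy li alpha pt pp.
Proof.
have := coupling_energyE tri alpha bli bs pt pp.
rewrite /biot !L2wNr !div_formN shNr kappa_formNr; lra.
Qed.

(** A test function without fluid pressure sees the Stokes form and the coupling of
    pt + alpha pp with q. *)
Lemma biot_stokes (u v : pwpolyv m) (pt pp q : pwpoly m) : biot st mu gamma2 lambda alpha s0 kappa (u, pt, pp) (v, q, 0) =
  stokes st mu gamma2 (u, pt) (v, q) -
  (L2w li pt q + L2w (fun z => alpha * li z) pp q).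
Proof. by rewrite /biot !L2w0 kappa_form0 !subr0 opprD addrA. Qed.

(* eta separates the two cases below; the bound C / (8 * (cl + 1)) keeps the cost of
   the coupling within half of what the Stokes test function provides. *)
Let eta := Num.min (2^-1) (C / (8 * (cl + 1))).

(** If the energy is at least eta^2 times the squared norm, the test function of the
    energy identity is used. Otherwise at least three quarters of the squared norm is
    the mass of pt, so that the Stokes test function gives C / 4 times the product of
    the norms, and the coupling term costs at most half of that because the coupling
    energy is small. *)
Lemma biot_infsup :
  ((Num.min (eta ^+ 2) (C / (8 * (1 + K))))%:E <=
    infsup S2 (biot st mu gamma2 lambda alpha s0 kappa) N2)%E.
Proof.
have eta0 : 0 < eta by rewrite lt_min invr_gt0 ltr0n divr_gt0// mulr_gt0// addr_gt0.
have eta1 : eta <= 2^-1 by rewrite ge_min lexx.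
have etaC : eta * (cl + 1) <= C / 8.
  rewrite -ler_pdivlMr ?addr_gt0// -mulrA -invfM ge_min lexx orbT//.
set beta := Num.min _ _.
have beta1 : beta <= eta ^+ 2 by rewrite ge_min lexx.
have beta2 : beta * (1 + K) <= C / 8.
  rewrite -ler_pdivlMr ?ltr_wpDr// -mulrA -invfM ge_min lexx orbT//.
have beta0 : 0 < beta.
  by rewrite lt_min exprn_gt0//= divr_gt0// mulr_gt0// ltr_wpDr.
apply: infsup_ge => -[[u pt] pp] Sx x0; have X0 := norm_biot_gt0 Sx x0.
have XE := norm_biot_sqr (u, pt, pp); have NE := norm_biotN u pt pp.
move: X0 XE NE; move: (N2 (u, pt, pp)) => X X0 XE NE.
have [uV ptQ ppQ] := Sx.
have h1 := elasticity_ge0 tri mu0 u.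
have h2 := L2w_ge0 tri pt wmu0.
have h3 := sh_ge0 tri mu0 st pt n0 g0.
have h4 := L2w_ge0 tri pp s00; have h5 := kappa_ge0 pp.
have h6 := coupling_energy_ge0 tri alpha li0 pt pp.
rewrite -[(u, pt, pp).1.1]/u -[(u, pt, pp).1.2]/pt -[(u, pt, pp).2]/pp in XE.
set T := elasticity mu u u + sh st mu gamma2 pt pt + (L2w s0 pp pp + kappa_form kappa pp pp)
  + coupling_energy li alpha pt pp.
have /orP[T1|T1] : (eta ^+ 2 * X ^+ 2 <= T) || (T < eta ^+ 2 * X ^+ 2) by rewrite leNgt orNb.
  exists (u, - pt, - pp); split.
  - split; [exact: uV|exact: QthN|exact: QphN].
  - by apply: contra x0; rewrite !xpair_eqE !oppr_eq0.
  - exact: X0.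
  - by rewrite NE.
  - by rewrite (biot_energy u pt pp) -/T NE -expr2; apply: le_trans T1; rewrite ler_wpM2r ?sqr_ge0.
have ET : coupling_energy li alpha pt pp <= eta ^+ 2 * X ^+ 2.
  by apply: le_trans (ltW T1); rewrite /T lerDr; do !apply: addr_ge0.
rewrite /T in T1.
have P2 : X / 2 <= normQt mu pt.
  apply: le_of_sqr; first exact: sqrtr_ge0.
  rewrite [leRHS]sqr_sqrtr//.
  have e2 : eta ^+ 2 <= 4^-1 by have := eta0; have := eta1; nra.
  have := ler_wpM2r (sqr_ge0 X) e2; have := sqr_ge0 X.
  rewrite expr_div_n; lra.
have x10 : (u, pt) != 0.
  apply/eqP => -[_ pt0]; move: P2; rewrite pt0 /normQt L2w0 sqrtr0; have := X0; lra.
have [[v q] [[vV qQ] y0 _ W0]] := infsup_witness C0 norm_stokes_ge0 stokesP (conj uV ptQ : S1 (u, pt)) x10.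
move=> hB; have WE : norm_stokes mu (v, q) = normV mu v + normQt mu q by [].
move: (norm_stokes mu (v, q)) W0 hB WE => W W0 hB WE.
have Vv := elasticity_ge0 tri mu0 v.
have Qq := L2w_ge0 tri q wmu0.
have sq := sqr_sqrtr Vv; have sQ := sqr_sqrtr Qq.
have v0 : 0 <= normV mu v by exact: sqrtr_ge0.
have q0 : 0 <= normQt mu q by exact: sqrtr_ge0.
have u0 : 0 <= normV mu u by exact: sqrtr_ge0.
rewrite -/(normV mu v) in sq; rewrite -/(normQt mu q) in sQ.
have W2 : elasticity mu v v + L2w wmu q q <= W ^+ 2.
  rewrite WE; exact: (sqr_sum_ge v0 q0 sq sQ).
have Sy : S2 (v, q, 0) by split => //=; exact: Qph0 ppQ.
have yN0 : (v, q, 0) != 0 :> biot_space m.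
  by apply: contra y0 => /eqP[-> ->].
have NY0 := norm_biot_gt0 Sy yN0.
have NY : N2 (v, q, 0) <= (1 + K) * W.
  apply: le_of_sqr; first by rewrite mulr_ge0 ?addr_ge0 ?(ltW W0).
  rewrite norm_biot_sqr /= L2w0 kappa_form0 !addr0.
  exact: (stabilized_norm_le K0 Vv Qq (shK qQ) W2).
exists (v, q, 0); split; [exact: Sy|exact: yN0|exact: X0|exact: NY0|].
rewrite (biot_stokes u v pt pp q).
(* This parameter balances the two terms of Young's inequality. *)
have th0 : 0 < eta * X / W by rewrite divr_gt0// mulr_gt0.
have Y := coupling_young tri alpha bli li0 pt pp q th0.
have L := L2w_le tri bli q bmu liP.
have LW : L2w li q q <= 2 * cl * W ^+ 2.
  apply: le_trans L _; apply: ler_wpM2l; first by rewrite mulr_ge0 ?(ltW cl0).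
  by apply: le_trans W2; rewrite lerDr.
set D := L2w li pt q + _ in Y *.
have DX : D <= eta * (cl + 1) * X * W.
  apply: le_trans Y _.
  have E1 : eta * X / W / 2 * L2w li q q <= eta * cl * X * W.
    apply: (@le_trans _ _ (eta * X / W / 2 * (2 * cl * W ^+ 2))).
      by rewrite ler_wpM2l// divr_ge0// ltW.
    rewrite le_eqVlt; apply/orP; left; apply/eqP; field; exact: lt0r_neq0.
  have E2 : (2 * (eta * X / W))^-1 * coupling_energy li alpha pt pp <= eta * X * W.
    apply: (@le_trans _ _ ((2 * (eta * X / W))^-1 * (2 * (eta ^+ 2 * X ^+ 2)))).
      apply: ler_wpM2l; first by rewrite invr_ge0 mulr_ge0 ?(ltW th0).
      apply: (@le_trans _ _ (eta ^+ 2 * X ^+ 2)).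
        exact: ET.
      by rewrite ler_peMl ?ler1n// mulr_ge0 ?sqr_ge0.
    rewrite le_eqVlt; apply/orP; left; apply/eqP; field; by rewrite !lt0r_neq0.
  apply: le_trans (lerD E1 E2) _.
  rewrite le_eqVlt; apply/orP; left; apply/eqP; ring.
have B1 : C / 4 * (X * W) <= stokes st mu gamma2 (u, pt) (v, q).
  apply: le_trans hB; rewrite /norm_stokes.
  rewrite [leLHS](_ : _ = C / 2 * (X / 2 * W)); last by field.
  by rewrite ler_pM2l ?divr_gt0// ler_pM2r//; apply: le_trans P2 _; rewrite lerDr.
have XW : 0 < X * W by rewrite mulr_gt0.
have B2 : beta * (X * N2 (v, q, 0)) <= C / 8 * (X * W).
  apply: (@le_trans _ _ (beta * (X * ((1 + K) * W)))).
    by rewrite ler_pM2l// ler_pM2l.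
  rewrite [leLHS](_ : _ = beta * (1 + K) * (X * W)); last by ring.
  by rewrite ler_pM2r.
have B3 : eta * (cl + 1) * X * W <= C / 8 * (X * W).
  by rewrite -mulrA ler_pM2r.
rewrite lerBrDr; apply: le_trans (lerD B2 (le_trans DX B3)) _; apply: le_trans B1.
rewrite le_eqVlt; apply/orP; left; apply/eqP; by field.
Qed.

End main.

Theorem theorem5p1 (R : realType) (n : nat) (Om Gp Gf Gd Gt : set 'rV[R]_n)
    (st : stabilization) (k : nat)
    (sigma gamma2 alpha c0 c1 mu_low mu_ratio lambda_low mu_lambda kappa_up C : R) :
  n = 2%N \/ n = 3%N ->
  polyhedral_lipschitz_domain Om ->
  boundary_partition Om Gp Gf -> boundary_partition Om Gd Gt ->
  ~ surface_null Gd -> ~ surface_null Gp ->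
  (0 < k)%N ->
  0 < sigma -> 0 < gamma2 -> 0 < alpha -> 0 <= c0 -> c0 <= c1 ->
  0 < mu_low -> 0 < mu_ratio -> 0 < lambda_low -> 0 < mu_lambda ->
  0 < kappa_up -> 0 < C ->
  exists beta : R, 0 < beta /\
    forall (m : mesh R n) (mu : 'rV[R]_n -> R) (lambda : 'rV[R]_n -> \bar R)
      (s0 : 'rV[R]_n -> R) (kappa : 'rV[R]_n -> 'M[R]_n)
      (mu_min mu_max kappa0 kappa1 : R),
    triangulation m Om -> shape_regular m sigma ->
    measurable_on (closure Om) mu ->
    mu_low <= mu_min -> mu_max <= mu_ratio * mu_min ->
    (forall x, closure Om x -> mu_min <= mu x /\ mu x <= mu_max) ->
    measurable_on (closure Om) lambda ->
    (forall x, closure Om x -> (lambda_low%:E <= lambda x)%E) ->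
    (forall x, closure Om x -> ((mu x)%:E <= mu_lambda%:E * lambda x)%E) ->
    measurable_on (closure Om) s0 ->
    (forall x, closure Om x -> c0 <= s0 x /\ s0 x <= c1) ->
    (forall i j, measurable_on (closure Om) (fun x => kappa x i j)) ->
    (exists M : R, forall x i j, closure Om x -> `|kappa x i j| <= M) ->
    0 < kappa0 -> kappa1 <= kappa_up ->
    (forall x (xi : 'rV[R]_n), closure Om x ->
       kappa0 * dotv xi xi <= (xi *m kappa x *m xi^T) 0 0 /\
       (xi *m kappa x *m xi^T) 0 0 <= kappa1 * dotv xi xi) ->
    (C%:E <= infsup [set x : pwpolyv m * pwpoly m | Vh Gd x.1 /\ Qth st x.2]
               (stokes st mu gamma2) (norm_stokes mu))%E ->
    (beta%:E <= infsup [set x : biot_space m |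
                          [/\ Vh Gd x.1.1, Qth st x.1.2 & Qph k Gp x.2]]
                  (biot st mu gamma2 lambda alpha s0 kappa)
                  (norm_biot st mu gamma2 s0 kappa))%E.
Proof.
move=> n23 [_ cO _ _ _] bd _ _ nGp k0 sig0 g0 al0 c00 c01 ml0 mr0 ll0 mlb0 _ C0.
have n0 : (0 < n)%N by case: n23 => ->.
have [K [K0 KP]] := sh_le Om st n0 sig0 mr0 g0.
exists (Num.min (Num.min (2^-1) (C / (8 * (mu_lambda + 1))) ^+ 2) (C / (8 * (1 + K)))).
split.
  have e0 : 0 < C / (8 * (mu_lambda + 1)) by rewrite divr_gt0// mulr_gt0// addr_gt0.
  have e1 : 0 < C / (8 * (1 + K)) by rewrite divr_gt0// mulr_gt0// ltr_wpDr.
  by rewrite lt_min exprn_gt0 ?e1// lt_min e0 invr_gt0 ltr0n.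
move=> m mu lambda s0 kappa mu_min mu_max kappa0 kappa1 tri reg mmu hmin hmax muP
  mlam lamlow lammu ms0 s0P mk bk k00 _ kP stokesP.
have mmin0 : 0 < mu_min by exact: lt_le_trans hmin.
have muP' x : closure Om x -> mu_min <= mu x <= mu_ratio * mu_min.
  by move=> /muP[h1 h2]; rewrite h1 (le_trans h2).
have mu0 x : closure Om x -> 0 < mu x.
  by move=> /muP[h1 _]; exact: lt_le_trans h1.
have kP' x (xi : 'rV[R]_n) : closure Om x -> kappa0 * dotv xi xi <= (xi *m kappa x *m xi^T) 0 0.
  by move=> xO; have [] := kP x xi xO.
apply: (@biot_infsup _ _ m Om Gp Gd) => //.
- exact: (bounded_meas_weight mmu mmin0 muP').
- exact: (bounded_meas_lambda_inv ll0).
- by move=> x /(lambda_inv_bounds ll0 lamlow)/andP[].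
- by move=> x xO; apply: (lambda_inv_le ll0 mlb0 lamlow xO (mu0 _ xO)); exact: lammu.
- split => //; exists c1 => x /s0P[h1 h2]; rewrite ger0_norm//; exact: le_trans h1.
- by move=> x /s0P[h1 _]; exact: le_trans h1.
- by move=> q; exact: (kappa_form_ge0 tri k00 kP').
- move=> q hq; exact: (Qph_definite n0 sig0 tri reg mk bk k00 kP' cO bd nGp k0 hq).
- exact: (KP m mu mu_min tri reg mmu mmin0 muP').
Qed.
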